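(* Let $Y\subset\mathbb{P}^5$ be a cubic fourfold with $\dim\mathrm{Sing}(Y)=1$. Assume $C\subseteq\mathrm{Sing}(Y)$ is an irreducible curve whose linear span is $4$-dimensional. Then $C$ is a rational normal quartic in $\mathbb{P}^4$. In suitable linear coordinates $(x_0:\dots:x_5)$ on $\mathbb{P}^5$, the equation of $Y$ can be taken of the form $$\det\begin{pmatrix} x_0 & x_1 & x_2+2ax_5 \\ x_1 & x_2-ax_5 & x_3 \\ x_2+2ax_5 & x_3 & x_4 \end{pmatrix}+x_5^2\,l(x_0,\dots,x_4)+bx_5^3,$$ where $a,b\in\mathbb{C}$ and $l$ is a linear form in $x_0,\dots,x_4$.
   Context: We work over $\mathbb{C}$. A cubic fourfold is a hypersurface in $\mathbb{P}^5$ given by a nonzero cubic form. *)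

(* Defs.v *)
From HB Require Import structures.
From mathcomp Require Import all_boot all_order all_algebra.
From mathcomp Require Import classical_sets reals.
From mathcomp Require Import complex.
From mathcomp Require Import mpoly.

Set Implicit Arguments.
Unset Strict Implicit.
Unset Printing Implicit Defensive.

Import GRing.Theory.
Local Open Scope ring_scope.
Local Open Scope classical_set_scope.

Section ProjectiveSpace.
Variables (K : fieldType) (n : nat).

(* P^n, as the type of lines through the origin of K^(n+1). *)
Definition proj_space := {L : {vspace 'rV[K]_n.+1} | \dim L == 1%N}.

Definition vanishes_at (f : {mpoly K[n.+1]}) (p : proj_space) : Prop :=
  forall v : 'rV[K]_n.+1, v \in val p -> f.@[fun i => v 0 i] = 0.

Definition zero_locus (S : set {mpoly K[n.+1]}) : set proj_space :=
  [set p | forall f, S f -> vanishes_at f p].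

Definition zariski_closed (Z : set proj_space) : Prop :=
  exists S : set {mpoly K[n.+1]},
    (forall f, S f -> exists d : nat, f \is d.-homog) /\ Z = zero_locus S.

Definition irreducible_closed (Z : set proj_space) : Prop :=
  [/\ zariski_closed Z,
      Z !=set0
    & forall A B : set proj_space, zariski_closed A -> zariski_closed B ->
        Z `<=` A `|` B -> Z `<=` A \/ Z `<=` B].

(* c 0, ..., c d is a chain of irreducible closed sets in Z; the values
   c i for i > d are irrelevant. *)
Definition irreducible_chain (Z : set proj_space) (d : nat)
    (c : nat -> set proj_space) : Prop :=
  (forall i, (i <= d)%N -> irreducible_closed (c i) /\ c i `<=` Z) /\
  (forall i, (i < d)%N -> c i `<` c i.+1).

(* Krull dimension of a closed set; no d qualifies when Z is empty. *)
Definition has_dim (Z : set proj_space) (d : nat) : Prop :=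
  (exists c, irreducible_chain Z d c) /\
  (forall e c, irreducible_chain Z e c -> (e <= d)%N).

Definition irreducible_curve (Z : set proj_space) : Prop :=
  irreducible_closed Z /\ has_dim Z 1.

(* The linear span of Z is the projectivization P(W). *)
Definition is_linear_span (Z : set proj_space)
    (W : {vspace 'rV[K]_n.+1}) : Prop :=
  (forall p, Z p -> (val p <= W)%VS) /\
  (forall W' : {vspace 'rV[K]_n.+1},
     (forall p, Z p -> (val p <= W')%VS) -> (W <= W')%VS).

Definition linear_span_dim (Z : set proj_space) (d : nat) : Prop :=
  exists W, is_linear_span Z W /\ \dim W = d.+1.

(* Singular locus of the hypersurface f = 0 (Jacobian criterion); f need not
   be reduced. *)
Definition sing_locus (f : {mpoly K[n.+1]}) : set proj_space :=
  [set p | vanishes_at f p /\ forall i, vanishes_at (f^`M(i)) p].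

Definition veronese (d : nat) (st : 'rV[K]_2) : 'rV[K]_d.+1 :=
  \row_(k < d.+1) (st 0 0 ^+ (d - k) * st 0 1 ^+ k).

(* Z is the image of the degree d Veronese map P^1 -> P^d followed by the
   linear embedding P^d -> P^n given by A. *)
Definition rational_normal_curve (d : nat) (Z : set proj_space) : Prop :=
  exists A : 'M[K]_(d.+1, n.+1), row_free A /\
    forall p, Z p <->
      exists st : 'rV[K]_2, st != 0 /\ val p = <[veronese d st *m A]>%VS.

(* f, written in the linear coordinates x_i = \sum_j A i j X_j. *)
Definition in_coords (A : 'M[K]_n.+1) (f : {mpoly K[n.+1]}) :
    {mpoly K[n.+1]} :=
  f \mPo [tuple \sum_(j < n.+1) A i j *: 'X_j | i < n.+1].

End ProjectiveSpace.

Section NormalForm.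
Variable K : fieldType.

Definition xvar (k : nat) : {mpoly K[6]} := 'X_(inord k).

Local Notation x k := (xvar k%N).

Definition normal_matrix (a : K) : 'M[{mpoly K[6]}]_3 :=
  let rows :=
    [:: [:: x 0                      ; x 1             ; x 2 + (2 * a) *: x 5];
        [:: x 1                      ; x 2 - a *: x 5  ; x 3                 ];
        [:: x 2 + (2 * a) *: x 5     ; x 3             ; x 4                 ]]
  in \matrix_(i < 3, j < 3) nth 0 (nth [::] rows i) j.

Definition normal_cubic (a b : K) (l : 'rV[K]_5) : {mpoly K[6]} :=
  \det (normal_matrix a)
  + xvar 5 ^+ 2 * (\sum_(i < 5) l 0 i *: xvar i)
  + b *: xvar 5 ^+ 3.

End NormalForm.

(* Main.v *)
Require Import Defs.
From HB Require Import structures.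
From mathcomp Require Import all_boot all_order all_algebra.
From mathcomp Require Import ring.
From mathcomp Require Import boolp classical_sets reals.
From mathcomp Require Import complex.
From mathcomp Require Import mpoly.

(* Polarize F to a symmetric trilinear form T; a vector v is singular when
   T v v w = 0 for all w. Let W be the span of C. If F vanished on P(W), its
   singular locus would contain a quadric threefold, so some T u3 u4 u2 is
   nonzero with the u's on C. By irreducibility C has a basis u0, ..., u4 of W
   with T u3 u4 u0, T u3 u4 u1, T u3 u4 u2 all nonzero. In these coordinates the
   restriction of F to W is squarefree, and the Cremona map y_i = 1/x_i makes
   its singular points linear: they form the kernel of a symmetric 5 x 5 matrix
   with zero diagonal and an invertible principal 3 x 3 block. So C lies in the
   Cremona image of a line y_i = al_i s + be_i t, which is a rational normal
   quartic, and C equals it because a binary form vanishing on infinitely many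
   points is zero. In Veronese coordinates, singularity along the quartic forces
   F to restrict to a multiple of the Hankel determinant, and the terms linear in
   the sixth coordinate form a quadric through the quartic. A translation of the
   sixth basis vector along W brings this quadric to a multiple of
   x0 x4 - 4 x1 x3 + 3 x2^2. *)

Set Implicit Arguments.
Unset Strict Implicit.
Unset Printing Implicit Defensive.

Import GRing.Theory Num.Theory.
Local Open Scope ring_scope.
Local Open Scope classical_set_scope.

(** * Polynomials as functions *)

Lemma poly_eq0_horner (K : numFieldType) (p : {poly K}) :
  (forall x, x != 0 -> p.[x] = 0) -> p = 0.
Proof.
move=> p0; apply/eqP; apply/negPn/negP => pn0.
have := max_poly_roots (rs := [seq (i.+1)%:R | i <- iota 0 (size p)]) pn0.
rewrite size_map size_iota ltnn map_inj_uniq ?iota_uniq; last first.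
  by move=> i j /eqP; rewrite eqr_nat => /eqP [].
suff -> : all (root p) [seq i.+1%:R | i <- iota 0 (size p)] by move=> /(_ erefl erefl).
by apply/allP => _ /mapP [i _ ->]; apply/eqP/p0; rewrite pnatr_eq0.
Qed.

Section MultivariateEvaluation.
Variable K : numFieldType.

Lemma horner_muni n (p : {mpoly K[n.+1]}) (v : 'I_n.+1 -> K) :
  p.@[v] =
  (map_poly (meval (fun i => v (widen_ord (leqnSn n) i))) (muni p)).[v ord_max].
Proof.
rewrite muniE raddf_sum /= horner_sum mevalE; apply: eq_bigr => m _.
rewrite -mul_polyC rmorphM /= map_polyC /= map_polyXn hornerM hornerC hornerXn.
rewrite mevalZ mevalX big_ord_recr /= mulrA; congr (_ * _ * _).
by apply: eq_bigr => i _; rewrite mnmE.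
Qed.

Lemma muni_eq0 n (p : {mpoly K[n.+1]}) : muni p = 0 -> p = 0.
Proof.
move=> p0; apply/mpolyP => m; rewrite mcoeff0.
have := congr1 (fun q : {poly {mpoly K[n]}} =>
  (q`_(m ord_max))@_[multinom m (widen_ord (leqnSn n) i) | i < n]) p0.
rewrite /= coef0 mcoeff0 => <-; rewrite muniE coef_sum raddf_sum /=.
rewrite {1}[p]mpolyE raddf_sum /=; apply: eq_bigr => m' _.
rewrite coefZ coefXn mcoeffZ mcoeffX.
have -> : (m' == m) = (m' ord_max == m ord_max) &&
    ([multinom m' (widen_ord (leqnSn n) i) | i < n] ==
     [multinom m (widen_ord (leqnSn n) i) | i < n] :> 'X_{1..n}).
  apply/eqP/andP => [->|[/eqP e1 /eqP/mnmP e2]]; first by rewrite !eqxx.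
  apply/mnmP => i; have [j ->|->//] := unliftP ord_max i.
  have := e2 j; rewrite !mnmE.
  suff -> : widen_ord (leqnSn n) j = lift ord_max j by [].
  by apply: val_inj; rewrite /= /bump leqNgt ltn_ord.
rewrite -scalerAl mcoeffZ; congr (_ * _).
rewrite [m ord_max == _]eq_sym.
case: eqP => _ /=; last by rewrite mulr0 mcoeff0.
by rewrite mulr1 mcoeffX.
Qed.

Lemma meval_inj0 n (p : {mpoly K[n]}) : (forall v, p.@[v] = 0) -> p = 0.
Proof.
elim: n p => [|n IH] p p0.
  have := p0 (fun=> 0).
  have -> : p = (p@_0%MM)%:MP.
    apply/mpolyP => m; rewrite mcoeffC.
    have -> : m = 0%MM by apply/mnmP => -[].
    by rewrite eqxx mulr1.
  by rewrite mevalC => ->.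
apply: muni_eq0; apply/polyP => k; rewrite coef0; apply: IH => v.
pose ex c (i : 'I_n.+1) := if unlift ord_max i is Some j then v j else c.
have /poly_eq0_horner : forall c, c != 0 -> (map_poly (meval v) (muni p)).[c] = 0.
  move=> c _; have := p0 (ex c); rewrite horner_muni {2}/ex unlift_none => <-.
  congr (_.[_]); apply: eq_map_poly => q; apply: meval_eq => i.
  have -> : widen_ord (leqnSn n) i = lift ord_max i.
    by apply: val_inj; rewrite /= /bump leqNgt ltn_ord.
  by rewrite /ex liftK.
by move=> /(congr1 (fun q : {poly K} => q`_k)); rewrite coef_map coef0.
Qed.

Lemma eq_meval n (p q : {mpoly K[n]}) : (forall v, p.@[v] = q.@[v]) -> p = q.
Proof.
move=> pq; apply/eqP; rewrite -subr_eq0; apply/eqP/meval_inj0 => v.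
by rewrite mevalB pq subrr.
Qed.

Lemma meval_homog n d (p : {mpoly K[n]}) (v : 'I_n -> K) c : p \is d.-homog ->
  p.@[fun i => c * v i] = c ^+ d * p.@[v].
Proof.
move=> /dhomogP hp; rewrite !mevalE mulr_sumr big_seq [RHS]big_seq.
apply: eq_bigr => m /hp hm; rewrite mulrCA; congr (_ * _).
rewrite -hm /= mdegE expr_sum -big_split /=.
by apply: eq_bigr => i _; rewrite exprMn.
Qed.

Lemma euler_homog n d (p : {mpoly K[n]}) (v : 'I_n -> K) : p \is d.-homog ->
  \sum_i v i * (p^`M(i)).@[v] = d%:R * p.@[v].
Proof.
move=> /dhomogP hp.
transitivity (\sum_(m <- msupp p) p@_m * \sum_i v i * ('X_[m]^`M(i)).@[v]).
  have dE i : (p^`M(i)).@[v] =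
      \sum_(m <- msupp p) p@_m * ('X_[m]^`M(i)).@[v].
    rewrite {1}[p]mpolyE (linear_sum (mderiv i)) /= (raddf_sum (meval v)) /=.
    apply: eq_bigr => m _.
    by rewrite mderivZ mevalZ.
  under eq_bigr => i _ do rewrite dE mulr_sumr.
  rewrite exchange_big /=; apply: eq_bigr => m _; rewrite mulr_sumr.
  by apply: eq_bigr => i _; rewrite mulrCA.
rewrite mevalE mulr_sumr big_seq [RHS]big_seq; apply: eq_bigr => m /hp hm.
rewrite mulrCA; congr (_ * _); rewrite -hm /= mdegE natr_sum mulr_suml.
apply: eq_bigr => i _; rewrite mderivX mevalZ mevalX.
have [->|mi] := posnP (m i); first by rewrite !mul0r mulr0.
rewrite mulrCA; congr (_ * _).
rewrite (bigD1 i) //= [RHS](bigD1 i) //= mulrA mnmBE mnm1E eqxx -exprS.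
rewrite subn1 prednK //; congr (_ * _); apply: eq_bigr => j ji.
by rewrite mnmBE mnm1E eq_sym (negbTE ji) subn0.
Qed.

Lemma mderiv_homog n d (p : {mpoly K[n]}) i :
  p \is d.+1.-homog -> p^`M(i) \is d.-homog.
Proof.
move=> /dhomogP hp; rewrite [p]mpolyE (linear_sum (mderiv i)) /=.
rewrite big_seq; apply: rpred_sum => m /hp hm; rewrite mderivZ mderivX.
have [->|mi] := posnP (m i); first by rewrite scale0r scaler0 rpred0.
apply: rpredZ; apply: rpredZ; rewrite dhomogX; apply/eqP.
have /(congr1 mdeg) : (m - U_(i) + U_(i) = m)%MM.
  by apply: submK; rewrite lep1mP -lt0n.
by rewrite mdegD mdeg1 addn1 hm => -[].
Qed.
End MultivariateEvaluation.

(** * The polar form of a cubic *)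

Section Polarization.
Variables (K : numFieldType) (n : nat) (F : {mpoly K[n]}).

Definition polar (u v w : 'rV[K]_n) : K :=
  \sum_i u 0 i * \sum_j v 0 j * \sum_k w 0 k *
    (F^`M(i)^`M(j)^`M(k)).@[fun=> 0].

Lemma polarC12 u v w : polar u v w = polar v u w.
Proof.
rewrite /polar; under eq_bigr => i _ do rewrite mulr_sumr.
rewrite exchange_big /=; apply: eq_bigr => j _.
rewrite mulr_sumr; apply: eq_bigr => i _; rewrite mulrCA.
by do 2!congr (_ * _); apply: eq_bigr => k _; rewrite (mderiv_comm i j).
Qed.

Lemma polarC23 u v w : polar u v w = polar u w v.
Proof.
rewrite /polar; apply: eq_bigr => l _; congr (_ * _).
under eq_bigr => i _ do rewrite mulr_sumr.
rewrite exchange_big /=; apply: eq_bigr => j _.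
rewrite mulr_sumr; apply: eq_bigr => i _; rewrite mulrCA.
by rewrite (mderiv_comm i j).
Qed.

Lemma polar_linear v w a u u' :
  polar (a *: u + u') v w = a * polar u v w + polar u' v w.
Proof.
rewrite /polar mulr_sumr -big_split /=; apply: eq_bigr => i _.
by rewrite !mxE mulrDl mulrA.
Qed.

Hypothesis Fcubic : F \is 3.-homog.

Lemma polar2E (v : 'rV[K]_n) i :
  \sum_j v 0 j * \sum_k v 0 k * (F^`M(i)^`M(j)^`M(k)).@[fun=> 0] =
  2 * (F^`M(i)).@[fun i => v 0 i].
Proof.
have Fi := mderiv_homog i Fcubic; rewrite -(euler_homog _ Fi).
apply: eq_bigr => j _; congr (_ * _).
have Fij := mderiv_homog j Fi; rewrite -[RHS]mul1r -(euler_homog _ Fij).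
apply: eq_bigr => k _; congr (_ * _).
have Fijk := mderiv_homog k Fij.
have := meval_homog (fun i => v 0 i) 0 Fijk; rewrite expr0 mul1r => <-.
by apply: meval_eq => l; rewrite mul0r.
Qed.

Lemma polar3E (v : 'rV[K]_n) : polar v v v = 6 * F.@[fun i => v 0 i].
Proof.
rewrite /polar; under eq_bigr => i _ do rewrite polar2E mulrCA.
by rewrite -mulr_sumr (euler_homog _ Fcubic) mulrA -natrM.
Qed.

Lemma polar_sing (v : 'rV[K]_n) :
  (forall w, polar v v w = 0) <->
  (forall i, (F^`M(i)).@[fun i => v 0 i] = 0).
Proof.
have pE w : polar v v w = \sum_i w 0 i * (2 * (F^`M(i)).@[fun i => v 0 i]).
  rewrite polarC23 polarC12 /polar; apply: eq_bigr => i _; congr (_ * _).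
  exact: polar2E.
split=> [Tv i|Fv w]; last by rewrite pE big1 // => i _; rewrite Fv !mulr0.
have := Tv (delta_mx 0 i); rewrite pE (bigD1 i) //= big1 ?addr0.
  by rewrite mxE !eqxx mul1r => /eqP; rewrite mulf_eq0 pnatr_eq0 => /eqP.
by move=> j /negbTE ji; rewrite mxE ji andbF mul0r.
Qed.

End Polarization.

(** * Homogeneous forms on an irreducible cone *)

Section ConeOverClosedSet.
Variables (K : numFieldType) (n : nat).
Local Notation vec := 'rV[K]_n.+1.

Definition ev (P : {mpoly K[n.+1]}) (v : vec) : K := P.@[fun i => v 0 i].

Definition cone (C : set (proj_space K n)) : set vec :=
  [set v | exists p, C p /\ v \in val p].

Lemma ev_homogZ d P a v : P \is d.-homog -> ev P (a *: v) = a ^+ d * ev P v.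
Proof.
move=> hP; rewrite /ev -(meval_homog _ _ hP).
by apply: meval_eq => i; rewrite mxE.
Qed.

Lemma dim_line (v : vec) : v != 0 -> \dim <[v]> == 1%N.
Proof. by move=> v0; rewrite dim_vline v0. Qed.

Definition line_of (v : vec) (v0 : v != 0) : proj_space K n :=
  exist _ <[v]>%VS (dim_line v0).

Lemma proj_lineP (p : proj_space K n) :
  exists2 v : vec, v != 0 & val p = <[v]>%VS.
Proof.
case: p => L /= dL; exists (vpick L).
  by rewrite vpick0 -dimv_eq0 (eqP dL).
apply/esym/eqP; rewrite eqEdim -memvE memv_pick (eqP dL) dim_vline.
by rewrite vpick0 -dimv_eq0 (eqP dL).
Qed.

Lemma vanishes_line d P (p : proj_space K n) v : P \is d.-homog ->
  val p = <[v]>%VS -> vanishes_at P p <-> ev P v = 0.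
Proof.
move=> hP pv; split=> [Pp|Pv w]; first by apply: Pp; rewrite pv memv_line.
by rewrite pv => /vlineP [a ->]; rewrite -/(ev P _) (ev_homogZ _ _ hP) Pv mulr0.
Qed.

Definition hpoly (f : vec -> K) : Prop :=
  exists d P, P \is d.-homog /\ forall v, f v = ev P v.

Lemma hpoly_mul f g : hpoly f -> hpoly g -> hpoly (fun v => f v * g v).
Proof.
move=> [d [P [hP fP]]] [e [Q [hQ gQ]]]; exists (d + e)%N, (P * Q).
by split=> [|v]; [exact: dhomogM|rewrite fP gQ /ev mevalM].
Qed.

Lemma hpoly_prod (I : eqType) (r : seq I) (f : I -> vec -> K) :
  (forall i, i \in r -> hpoly (f i)) -> hpoly (fun v => \prod_(i <- r) f i v).
Proof.
elim: r => [|i r IH] hf.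
  by exists 0%N, 1; rewrite dhomog1; split=> // v; rewrite big_nil /ev meval1.
have hr : forall j, j \in r -> hpoly (f j).
  by move=> j jr; apply: hf; rewrite inE jr orbT.
have [d [P [hP E]]] := hpoly_mul (hf i (mem_head i r)) (IH hr).
by exists d, P; split=> // v; rewrite big_cons E.
Qed.

Lemma linear_mpoly (f : vec -> K) :
  (forall a u v, f (a *: u + v) = a * f u + f v) ->
  exists2 P, P \is 1.-homog & forall v, f v = ev P v.
Proof.
move=> lf; have f0 : f 0 = 0.
  by have := lf (-1) 0 0; rewrite scaler0 addr0 mulN1r addNr.
have fD u v : f (u + v) = f u + f v by rewrite -[u]scale1r lf mul1r scale1r.
have fZ a u : f (a *: u) = a * f u by rewrite -[a *: u]addr0 lf f0 addr0.
exists (\sum_i f (delta_mx 0 i) *: 'X_i).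
  apply: rpred_sum => i _.
  apply: rpredZ.
  by rewrite dhomogX; apply/eqP/mdeg1.
move=> v; rewrite {1}[v]row_sum_delta (big_morph f fD f0) /ev raddf_sum /=.
by apply: eq_bigr => i _; rewrite fZ mevalZ mevalXU mulrC.
Qed.

Lemma hpoly_linear (f : vec -> K) :
  (forall a u v, f (a *: u + v) = a * f u + f v) -> hpoly f.
Proof. by move=> /linear_mpoly [P hP fP]; exists 1%N, P. Qed.

Variable C : set (proj_space K n).
Hypothesis Cirr : irreducible_closed C.
Local Notation X := (cone C).

Lemma cone_scale a v : X v -> X (a *: v).
Proof. by move=> [p [Cp vp]]; exists p; split=> //; apply: memvZ. Qed.

Lemma cone_irreducible f g : hpoly f -> hpoly g ->
  (forall v, X v -> f v * g v = 0) ->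
  (forall v, X v -> f v = 0) \/ (forall v, X v -> g v = 0).
Proof.
move=> [d [P [hP fP]]] [e [Q [hQ gQ]]] fg0; case: Cirr => _ _ irr.
pose Z (S : {mpoly K[n.+1]}) := zero_locus [set S].
have cl k S : S \is k.-homog -> zariski_closed (Z S).
  by move=> hS; exists [set S]; split=> // _ ->; exists k.
have [p Cp|h|h] := irr _ _ (cl _ _ hP) (cl _ _ hQ).
- have [v v0 pv] := proj_lineP p.
  have /eqP : f v * g v = 0 by apply: fg0; exists p; rewrite pv memv_line.
  rewrite mulf_eq0 fP gQ => /orP [] /eqP h; [left|right] => _ ->.
    exact/(vanishes_line hP pv).
  exact/(vanishes_line hQ pv).
- by left=> v [p [Cp vp]]; rewrite fP; apply: (h p Cp P).
- by right=> v [p [Cp vp]]; rewrite gQ; apply: (h p Cp Q).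
Qed.

Lemma cone_closed v : v != 0 ->
  (forall d P, P \is d.-homog -> (forall x, X x -> ev P x = 0) -> ev P v = 0) ->
  X v.
Proof.
move=> v0 Xv; exists (line_of v0); split; last exact: memv_line.
case: Cirr => -[S [hS ES]] _ _; rewrite {1}ES => P SP.
have [d hP] := hS _ SP; apply/(vanishes_line (v := v) hP) => //.
apply: (Xv d P hP) => x [p [Cp xp]].
by move: Cp; rewrite ES => /(_ P SP); apply.
Qed.

Lemma cone_mem v (p : proj_space K n) : v != 0 -> val p = <[v]>%VS ->
  C p <-> X v.
Proof.
move=> v0 pv; split=> [Cp|[q [Cq vq]]]; first by exists p; rewrite pv memv_line.
suff -> : p = q by [].
apply: val_inj; rewrite pv; apply/eqP.
by rewrite eqEdim -memvE vq dim_vline v0 (eqP (valP q)).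
Qed.

Lemma hpoly_pick f g : hpoly f -> hpoly g ->
  (exists2 v, X v & f v != 0) -> (exists2 v, X v & g v != 0) ->
  exists2 v, X v & f v * g v != 0.
Proof.
move=> hf hg [v Xv fv] [w Xw gw]; apply: contrapT => H.
have [x Xx|h|h] := cone_irreducible hf hg.
- by apply/eqP/negPn/negP => fg; apply: H; exists x.
- by move: fv; rewrite h ?eqxx.
- by move: gw; rewrite h ?eqxx.
Qed.

Lemma hpoly_pick_prod (I : eqType) (r : seq I) (f : I -> vec -> K) :
  (exists v, X v) ->
  (forall i, i \in r -> hpoly (f i)) ->
  (forall i, i \in r -> exists2 v, X v & f i v != 0) ->
  exists2 v, X v & forall i, i \in r -> f i v != 0.
Proof.
move=> [x0 Xx0] hf nf.
suff [v Xv pv] : exists2 v, X v & \prod_(i <- r) f i v != 0.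
  exists v => // i ir; apply: contraNneq pv => fi.
  by rewrite prodf_seq_eq0; apply/hasP; exists i; rewrite ?fi ?eqxx.
elim: r hf nf => [|i r IH] hf nf; first by exists x0; rewrite // big_nil oner_eq0.
have hr j : j \in r -> j \in i :: r by rewrite inE => ->; rewrite orbT.
have hi := mem_head i r.
have [||v Xv pv] := hpoly_pick (hf i hi) (hpoly_prod (f := f) (r := r) _) (nf i hi).
- by move=> j /hr; apply: hf.
- by apply: IH => j /hr; [apply: hf|apply: nf].
by exists v; rewrite // big_cons.
Qed.

Variable W : {vspace vec}.
Hypothesis CW : is_linear_span C W.

Lemma cone_span v : X v -> v \in W.
Proof. by move=> [p [Cp vp]]; case: CW => /(_ p Cp) /subvP/(_ v vp). Qed.

Lemma cone_subspan (V : {vspace vec}) : (forall v, X v -> v \in V) -> (W <= V)%VS.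
Proof.
move=> XV; case: CW => _; apply=> p Cp; apply/subvP => v vp.
by apply: XV; exists p.
Qed.

Lemma linear_span_eq0 (f : vec -> K) :
  (forall a u v, f (a *: u + v) = a * f u + f v) ->
  (forall v, X v -> f v = 0) -> forall v, v \in W -> f v = 0.
Proof.
move=> lf f0 v vW.
pose fl := GRing.isLinear.Build K vec K^o *%R f lf.
pose g : {linear vec -> K^o} := HB.pack f fl.
have : (W <= lker (linfun g))%VS.
  by apply: cone_subspan => x Xx; rewrite memv_ker lfunE /=; apply/eqP/f0.
by move=> /subvP/(_ v vW); rewrite memv_ker lfunE => /eqP.
Qed.

Lemma cone_avoid (V : {vspace vec}) (g : vec -> K) : ~~ (W <= V)%VS ->
  hpoly g -> (exists2 v, X v & g v != 0) ->
  exists2 v, X v & (v \notin V) && (g v != 0).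
Proof.
move=> WV hg gn0.
have [x Xx xV] : exists2 x, X x & x \notin V.
  apply: contrapT => H; move/negP: WV; apply; apply: cone_subspan => v Xv.
  by apply/negPn/negP => vV; apply: H; exists v.
have [i xi] : exists i, (x - projv V x) 0 i != 0.
  apply/existsP; rewrite -negb_forall; apply: contraNN xV => /forallP h.
  suff /eqP : x - projv V x = 0 by rewrite subr_eq0 => /eqP ->; apply: memv_proj.
  by apply/rowP => i; rewrite (eqP (h i)) mxE.
pose f v := (v - projv V v) 0 i.
have hf : hpoly f.
  by apply: hpoly_linear => a u v; rewrite /f linearP !mxE; ring.
have [||v Xv] := hpoly_pick hf hg; [by exists x|by []|].
rewrite mulf_eq0 negb_or => /andP [fv gv]; exists v => //; rewrite gv andbT.
by apply: contraNN fv => vV; rewrite /f projv_id // subrr mxE.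
Qed.

End ConeOverClosedSet.

(** * Closures of polynomial images *)

Section PolynomialImages.
Variables (K : numFieldType) (n : nat).
Local Notation vec := 'rV[K]_n.+1.

Definition polyfun (f : vec -> K) : Prop :=
  exists P : {mpoly K[n.+1]}, forall x, f x = ev P x.

Definition polymap (phi : vec -> vec) : Prop := forall i, polyfun (fun x => phi x 0 i).

Lemma polyfun_const c : polyfun (fun=> c).
Proof. by exists c%:MP => x; rewrite /ev mevalC. Qed.

Lemma polyfun_coord i : polyfun (fun x => x 0 i).
Proof. by exists 'X_i => x; rewrite /ev mevalXU. Qed.

Lemma polyfun_add f g : polyfun f -> polyfun g -> polyfun (fun x => f x + g x).
Proof. by move=> [P fP] [Q gQ]; exists (P + Q) => x; rewrite fP gQ /ev mevalD. Qed.

Lemma polyfun_mul f g : polyfun f -> polyfun g -> polyfun (fun x => f x * g x).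
Proof. by move=> [P fP] [Q gQ]; exists (P * Q) => x; rewrite fP gQ /ev mevalM. Qed.

Lemma polyfun_sum m (f : 'I_m -> vec -> K) :
  (forall i, polyfun (f i)) -> polyfun (fun x => \sum_i f i x).
Proof.
move=> /fin_all_exists [P fP]; exists (\sum_i P i) => x.
by rewrite /ev raddf_sum; apply: eq_bigr.
Qed.

Lemma polymap_comp phi psi : polymap phi -> polymap psi -> polymap (phi \o psi).
Proof.
move=> hphi /fin_all_exists [s hs] i; have [P hP] := hphi i.
exists (P \mPo [tuple s j | j < n.+1]) => x; rewrite /= hP /ev comp_mpoly_meval.
by apply: meval_eq => j; rewrite tnth_mktuple hs.
Qed.

Lemma polymap_linear (f : {linear vec -> vec}) : polymap f.
Proof.
move=> i; have [a u v|d [P [_ hP]]] := @hpoly_linear K n (fun x => f x 0 i).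
  by rewrite linearP !mxE.
by exists P.
Qed.

Lemma polyfun_neq0M f g : polyfun f -> polyfun g ->
  (exists x, f x != 0) -> (exists x, g x != 0) -> exists x, f x * g x != 0.
Proof.
move=> [P fP] [Q gQ] [x fx] [y gy]; apply: contrapT => H.
have : P * Q = 0.
  apply: meval_inj0 => v; apply/eqP/negPn/negP => PQv; apply: H.
  exists (\row_i v i); rewrite fP gQ -mevalM; move: PQv.
  by rewrite (meval_eq (v2 := fun i => (\row_i v i) 0 i)) // => i; rewrite mxE.
move=> /eqP; rewrite mulf_eq0 => /orP [] /eqP E; [move: fx|move: gy].
  by rewrite fP E /ev meval0 eqxx.
by rewrite gQ E /ev meval0 eqxx.
Qed.

Definition image_closure (phi : vec -> vec) : set (proj_space K n) :=
  zero_locus [set P : {mpoly K[n.+1]} |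
    (exists d : nat, P \is d.-homog) /\ forall x, ev P (phi x) = 0].

Lemma mem_image_closure phi x (p : proj_space K n) :
  val p = <[phi x]>%VS -> image_closure phi p.
Proof. by move=> px P [[d hP] Pphi]; apply/(vanishes_line hP px). Qed.

Lemma image_closure_irreducible phi : polymap phi -> (exists x, phi x != 0) ->
  irreducible_closed (image_closure phi).
Proof.
move=> hphi [x0 px0]; split.
- by eexists; split; last reflexivity; move=> P [].
- by exists (line_of px0); apply: (mem_image_closure (x := x0)).
move=> _ _ [SA [hA ->]] [SB [hB ->]] AB.
have out S : (forall P, S P -> exists d : nat, P \is d.-homog) ->
    ~ (image_closure phi `<=` zero_locus S) ->
    exists2 P, S P & exists x, ev P (phi x) != 0.
  move=> hS /existsNP [p] /not_implyP [Zp] /existsNP [P] /not_implyP [SP np].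
  exists P => //; apply: contrapT => H; apply: np; apply: Zp.
  split; first exact: hS.
  by move=> x; apply/eqP/negPn/negP => h; apply: H; exists x.
apply: contrapT => /not_orP [/(out _ hA) [P SP Px] /(out _ hB) [Q SQ Qx]].
have evp R : polyfun (fun x => ev R (phi x)).
  have /fin_all_exists [s hs] := hphi; exists (R \mPo [tuple s j | j < n.+1]) => x.
  rewrite /ev comp_mpoly_meval; apply: meval_eq => j.
  by rewrite tnth_mktuple hs.
have [i pi0] : exists i, phi x0 0 i != 0.
  apply/existsP; rewrite -negb_forall; apply: contraNN px0 => /forallP h.
  by apply/eqP/rowP => i; rewrite (eqP (h i)) mxE.
have PQ := polyfun_neq0M (evp P) (evp Q) Px Qx.
have [|x] := polyfun_neq0M (hphi i) (polyfun_mul (evp P) (evp Q)) _ PQ.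
  by exists x0.
rewrite !mulf_eq0 !negb_or => /and3P [pxi Pxn Qxn].
have px : phi x != 0 by apply: contraNneq pxi => ->; rewrite mxE.
have [d hP] := hA _ SP; have [e hQ] := hB _ SQ.
have lx : val (line_of px) = <[phi x]>%VS by [].
case: (AB _ (mem_image_closure lx)) => [/(_ P SP)|/(_ Q SQ)].
  by move=> /(vanishes_line hP lx) /eqP; rewrite (negbTE Pxn).
by move=> /(vanishes_line hQ lx) /eqP; rewrite (negbTE Qxn).
Qed.

Lemma image_closure_sub phi psi : (forall x, exists y, phi x = psi y) ->
  image_closure phi `<=` image_closure psi.
Proof.
move=> sub p Zp P [hP Ppsi]; apply: Zp; split=> // x.
by have [y ->] := sub x.
Qed.

Lemma image_closure_vspace phi (M : {vspace vec}) p :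
  (forall x, phi x \in M) -> image_closure phi p -> (val p <= M)%VS.
Proof.
move=> pM Zp; apply/subvP => v vp.
suff /eqP : v - projv M v = 0 by rewrite subr_eq0 => /eqP ->; apply: memv_proj.
apply/rowP => i; rewrite [RHS]mxE.
have [a u w|d [P [hP E]]] := @hpoly_linear K n (fun x => (x - projv M x) 0 i).
  by rewrite linearP !mxE; ring.
rewrite E; apply: (Zp P) vp; split; first by exists d.
by move=> x; rewrite -E projv_id // subrr mxE.
Qed.

Variable F : {mpoly K[n.+1]}.
Hypothesis Fcubic : F \is 3.-homog.

Lemma image_closure_sing phi :
  (forall x w, polar F (phi x) (phi x) w = 0) ->
  image_closure phi `<=` sing_locus F.
Proof.
move=> pF p Zp; split=> [|i]; apply: Zp; split.
- by exists 3%N.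
- move=> x; have /eqP := polar3E Fcubic (phi x).
  by rewrite pF eq_sym mulf_eq0 pnatr_eq0 => /eqP.
- by exists 2%N; apply: mderiv_homog.
by move=> x; have /(polar_sing Fcubic) := pF x; apply.
Qed.

Lemma sing_locus_flag phi (M0 M1 M2 : {vspace vec}) w0 w1 w2 m0 m1 m2 :
  has_dim (sing_locus F) 1 -> polymap phi -> (M0 <= M1)%VS -> (M1 <= M2)%VS ->
  (forall x, x \in M0 -> phi x \in M0) ->
  (forall x, x \in M1 -> phi x \in M1) ->
  w0 \in M0 -> w1 \in M1 -> w1 \notin M0 -> w2 \in M2 -> w2 \notin M1 ->
  phi w0 = m0 *: w0 -> phi w1 = m1 *: w1 -> phi w2 = m2 *: w2 ->
  m0 *: w0 != 0 -> m1 != 0 -> m2 != 0 ->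
  (forall x w, x \in M2 -> polar F (phi x) (phi x) w = 0) -> False.
Proof.
move=> [_ dimF] hphi M01 M12 phiM0 phiM1 w0M w1M w1M0 w2M w2M1 e0 e1 e2
  n0 n1 n2 sing.
pose Z M := image_closure (phi \o projv M).
have Zirr (M : {vspace vec}) w m : w \in M -> phi w = m *: w -> m *: w != 0 ->
    irreducible_closed (Z M).
  move=> wM e ne; apply: image_closure_irreducible.
    exact: polymap_comp hphi (polymap_linear _).
  by exists w; rewrite /= projv_id // e.
have Zsub (M N : {vspace vec}) : (M <= N)%VS -> Z M `<=` Z N.
  move=> MN; apply: image_closure_sub => x; exists (projv M x).
  by rewrite /= [projv N _]projv_id // (subvP MN) // memv_proj.
have Zprop (M N : {vspace vec}) w m : (M <= N)%VS ->
    (forall x, x \in M -> phi x \in M) -> w \in N -> w \notin M ->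
    phi w = m *: w -> m != 0 -> Z M `<` Z N.
  move=> MN pM wN wM ew mn; split; first exact: Zsub.
  have wn : w != 0 by apply: contraNneq wM => ->; apply: mem0v.
  move=> /(_ (line_of wn)) H; move/negP: wM; apply.
  have : Z M (line_of wn).
    apply: H; apply: (mem_image_closure (x := w)); rewrite /= projv_id // ew.
    apply/eqP; rewrite eq_sym eqEdim -memvE memvZ ?memv_line //=.
    by rewrite !dim_vline scaler_eq0 negb_or mn wn.
  move=> /(image_closure_vspace (M := M)); rewrite -memvE; apply.
  by move=> x; apply: pM; apply: memv_proj.
have wnz (M : {vspace vec}) (w : vec) (m : K) :
    w \notin M -> m != 0 -> m *: w != 0.
  move=> wM mn; rewrite scaler_eq0 negb_or mn /=.
  by apply: contraNneq wM => ->; apply: mem0v.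
have ZF M : (M <= M2)%VS -> Z M `<=` sing_locus F.
  move=> MM; apply: image_closure_sing => x w; apply: sing.
  by rewrite (subvP MM) // memv_proj.
pose c i := if i is i'.+1 then if i' is _.+1 then Z M2 else Z M1 else Z M0.
suff /(dimF 2%N) : irreducible_chain (sing_locus F) 2 c by [].
split=> [[|[|[|//]]] _|[|[|//]] _].
- by split; [exact: Zirr e0 n0|apply: ZF; exact: subv_trans M12].
- by split; [exact: Zirr e1 (wnz _ _ _ w1M0 n1)|exact: ZF].
- by split; [exact: Zirr e2 (wnz _ _ _ w2M1 n2)|exact: ZF].
- exact: (Zprop _ _ _ _ M01 phiM0 w1M w1M0 e1 n1).
exact: (Zprop _ _ _ _ M12 phiM1 w2M w2M1 e2 n2).
Qed.

End PolynomialImages.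

Section PolarArithmetic.
Variables (K : numFieldType) (n : nat) (F : {mpoly K[n]}).
Local Notation T := (polar F).

Lemma polarD1 u u' v w : T (u + u') v w = T u v w + T u' v w.
Proof. by rewrite -[u]scale1r polar_linear mul1r scale1r. Qed.
Lemma polarZ1 a u v w : T (a *: u) v w = a * T u v w.
Proof.
have T0 : T 0 v w = 0.
  by have := polar_linear F v w (-1) 0 0; rewrite scaler0 addr0 mulN1r addNr.
by rewrite -[a *: u]addr0 polar_linear T0 addr0.
Qed.
Lemma polarD2 u v v' w : T u (v + v') w = T u v w + T u v' w.
Proof. by rewrite polarC12 polarD1 !(polarC12 _ u). Qed.
Lemma polarZ2 a u v w : T u (a *: v) w = a * T u v w.
Proof. by rewrite polarC12 polarZ1 (polarC12 _ u). Qed.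
Lemma polarD3 u v w w' : T u v (w + w') = T u v w + T u v w'.
Proof. by rewrite polarC23 polarD2 !(polarC23 _ u v). Qed.
Lemma polarZ3 a u v w : T u v (a *: w) = a * T u v w.
Proof. by rewrite polarC23 polarZ2 (polarC23 _ u v). Qed.

Definition polarE := (polarD1, polarD2, polarD3, polarZ1, polarZ2, polarZ3).

Lemma polar_sum1 m (a : 'I_m -> K) (f : 'I_m -> 'rV_n) v w :
  T (\sum_i a i *: f i) v w = \sum_i a i * T (f i) v w.
Proof.
have T0 : T 0 v w = 0 by rewrite -(scale0r 0) polarZ1 mul0r.
rewrite (big_morph (fun x => T x v w) (fun x y => polarD1 x y v w) T0).
by apply: eq_bigr => i _; rewrite polarZ1.
Qed.
Lemma polar_sum2 m (a : 'I_m -> K) (f : 'I_m -> 'rV_n) v w :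
  T v (\sum_i a i *: f i) w = \sum_i a i * T v (f i) w.
Proof. by rewrite polarC12 polar_sum1; apply: eq_bigr => i _; rewrite polarC12. Qed.
Lemma polar_sum3 m (a : 'I_m -> K) (f : 'I_m -> 'rV_n) v w :
  T v w (\sum_i a i *: f i) = \sum_i a i * T v w (f i).
Proof. by rewrite polarC23 polar_sum2; apply: eq_bigr => i _; rewrite polarC23. Qed.

End PolarArithmetic.

(** * The cubic does not vanish on the span *)

Section HyperplaneSection.
Variables (K : numFieldType) (n : nat) (F : {mpoly K[n.+1]}).
Local Notation vec := 'rV[K]_n.+1.
Local Notation T := (polar F).
Hypothesis Fcubic : F \is 3.-homog.

Lemma polyfun_polar_diag e : polyfun (fun x : vec => T x x e).
Proof.
do 2!(apply: polyfun_sum => ?; apply: polyfun_mul; first exact: polyfun_coord).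
exact: polyfun_const.
Qed.

Lemma polyfun_polar u e : polyfun (fun x : vec => T u x e).
Proof.
apply: polyfun_sum => i; apply: polyfun_mul; first exact: polyfun_const.
apply: polyfun_sum => j; apply: polyfun_mul; first exact: polyfun_coord.
exact: polyfun_const.
Qed.

Variables (C : set (proj_space K n)) (W : {vspace vec}).
Hypotheses (Cirr : irreducible_closed C) (CW : is_linear_span C W).
Hypothesis Csing : C `<=` sing_locus F.
Local Notation X := (cone C).

Lemma cone_sing v w : X v -> T v v w = 0.
Proof.
move=> [p [Cp vp]]; have [_ dF] := Csing Cp.
by move: w; apply/(polar_sing Fcubic) => i; apply: dF.
Qed.

Lemma cone_span_polar0 e : (forall x y, X x -> X y -> T x y e = 0) ->
  forall x y, x \in W -> y \in W -> T x y e = 0.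
Proof.
move=> T0 x y xW yW.
apply: (linear_span_eq0 CW (f := fun x => T x y e)) xW => [a u v|u Xu].
  exact: polar_linear.
apply: (linear_span_eq0 CW (f := fun y => T u y e)) yW => [a v v'|v Xv].
  by rewrite !polarE.
exact: T0.
Qed.

Hypotheses (dimW : (3 < \dim W)%N) (Wn : (\dim W = n)%N).
Hypothesis dimF : has_dim (sing_locus F) 1.

(* If F vanishes on P(W), its singular locus contains the quadric cut out on
   P(W) by T x x e, which would have dimension at most 1. The map
   x |-> T x x e *: u - 2 * T u x e *: x parametrizes this quadric from its
   point u: it is the second intersection with the line ux, up to scaling. *)
Lemma cubic_nonzero_on_span :
  exists x y z, [/\ X x, X y, X z & T x y z != 0].
Proof.
apply: contrapT => H.
have T0W e : X e -> forall x y, x \in W -> y \in W -> T x y e = 0.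
  move=> Xe; apply: cone_span_polar0 => x y Xx Xy.
  by apply/eqP/negPn/negP => h; apply: H; exists x, y, e.
have T0 x y z : x \in W -> y \in W -> z \in W -> T x y z = 0.
  move=> xW yW zW.
  apply: (linear_span_eq0 CW (f := fun z => T x y z)) zW => [a v v'|v Xv].
    by rewrite !polarE.
  exact: T0W.
have dim_lt (s : seq vec) : (size s <= 3)%N -> ~~ (W <= <<s>>)%VS.
  move=> s3; apply/negP => /dimvS h; have := leq_trans h (dim_span s).
  by rewrite leqNgt (leq_ltn_trans s3 dimW).
have [e eW] : exists e : vec, e \notin W.
  apply: contrapT => He; have : (fullv <= W)%VS.
    apply/subvP => v _; apply/negPn/negP => h; apply: He; by exists v.
  by move=> /dimvS; rewrite dimvf /dim /= mul1n Wn ltnn.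
have We (w : vec) : exists2 w', w' \in W & exists a, w = w' + a *: e.
  have : w \in (W + <[e]>)%VS.
    suff -> : (W + <[e]>)%VS = fullv by apply: memvf.
    apply/eqP; rewrite eqEdim subvf dimvf /dim /= mul1n dimv_disjoint_sum.
      rewrite Wn dim_vline; suff -> : e != 0 by rewrite addn1.
      by apply: contraNneq eW => ->; apply: mem0v.
    apply/eqP; rewrite -subv0; apply/subvP => x.
    rewrite memv_cap => /andP [xW /vlineP [a xa]].
    have [a0|an] := eqVneq a 0; first by rewrite xa a0 scale0r memv0.
    move/negP: eW; case; rewrite -[e]scale1r -(mulVf an) -scalerA -xa.
    exact: memvZ.
  by move=> /memv_addP [w' wW [x /vlineP [a ->] ->]]; exists w' => //; exists a.
have singW x : x \in W -> T x x e = 0 -> forall w, T x x w = 0.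
  move=> xW xe w; have [w' wW [a ->]] := We w.
  by rewrite !polarE xe T0 // mulr0 addr0.
have [x0 Xx0] : exists x, X x.
  have [] := cone_avoid Cirr CW (V := <<[::]>>%VS) (g := fun=> 1) (dim_lt [::] _).
  - by [].
  - by exists 0%N, 1; rewrite dhomog1; split=> // v; rewrite /ev meval1.
  - case: Cirr => _ [p Cp] _; have [v _ pv] := proj_lineP p.
    by exists v; [exists p; rewrite pv memv_line|rewrite oner_eq0].
  by move=> v Xv _; exists v.
have XW := cone_span CW.
have flag (g : vec -> K) (u : vec) phi (m : vec -> K) :
    (forall a u v, g (a *: u + v) = a * g u + g v) \/ (forall x, g x = 1) ->
    X u -> (exists2 x, X x & g x != 0) ->
    polymap phi -> (forall x, exists a b, phi x = a *: u + b *: x) ->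
    (forall x, X x -> phi x = m x *: x) ->
    (forall x, X x -> g x != 0 -> m x != 0) ->
    (forall x, x \in W -> T (phi x) (phi x) e = 0) -> False.
  move=> lg Xu gn hphi pu pm mn ps.
  have hg : hpoly g.
    case: lg => [lg|g1]; first exact: hpoly_linear.
    exists 0%N, 1; rewrite dhomog1; split=> // v.
    by rewrite g1 /ev meval1.
  have av s : (size s <= 3)%N ->
      exists2 v, X v & (v \notin <<s>>%VS) && (g v != 0).
    by move=> /dim_lt s3; apply: (cone_avoid Cirr CW s3 hg gn).
  have [v Xv /andP [v0 gv]] := av [::] isT.
  have [v' Xv' /andP [vv' gv']] := av [:: v] isT.
  have [w Xw /andP [vw gw]] := av [:: u; v; v'] isT.
  have phiW (M : {vspace vec}) : u \in M -> forall x, x \in M -> phi x \in M.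
    move=> uM x xM; have [a [b ->]] := pu x.
    by apply: memvD; apply: memvZ.
  have M01 : (<<[:: v]>> <= <<[:: u; v; v']>>)%VS.
    by apply: sub_span => x; rewrite !inE => ->; rewrite orbT.
  have M12 : (<<[:: u; v; v']>> <= W)%VS.
    by apply/span_subvP => x; rewrite !inE => /or3P [] /eqP ->; apply: XW.
  apply: (sing_locus_flag Fcubic dimF hphi M01 M12 _ _ _ _ vv' _ vw
    (pm v Xv) (pm v' Xv') (pm w Xw) _ (mn v' Xv' gv') (mn w Xw gw)) => //.
  - move=> x; rewrite span_seq1 => /vlineP [a ->].
    by rewrite pm ?scalerA ?memvZ ?memv_line //; apply: cone_scale.
  - by apply: phiW; apply: memv_span; rewrite mem_head.
  - by rewrite span_seq1 memv_line.
  - by apply: memv_span; rewrite !inE eqxx !orbT.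
  - exact: XW.
  - rewrite scaler_eq0 negb_or mn //=; apply: contraNneq v0 => ->; exact: mem0v.
  move=> x y xW; apply: singW; last exact: ps.
  exact: phiW (XW _ Xu) x xW.
have [[u [v [Xu Xv uv]]]|H2] := pselect (exists u v, [/\ X u, X v & T u v e != 0]).
  pose phi (x : vec) := T x x e *: u + (- 2 * T u x e) *: x.
  apply: (flag (fun x => T u x e) u phi (fun x => - 2 * T u x e)) => //.
  - by left=> a v1 v2; rewrite !polarE.
  - by exists v.
  - move=> i; suff [P hP] : polyfun
        (fun x : vec => T x x e * u 0 i + (- 2 * T u x e) * x 0 i).
      by exists P => x; rewrite -hP !mxE.
    apply: polyfun_add; apply: polyfun_mul.
    + exact: polyfun_polar_diag.
    + exact: polyfun_const.
    + by apply: polyfun_mul; [exact: polyfun_const|exact: polyfun_polar].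
    + exact: polyfun_coord.
  - by move=> x; exists (T x x e), (- 2 * T u x e).
  - by move=> x Xx; rewrite /phi cone_sing // scale0r add0r.
  - by move=> x Xx uxe; rewrite mulf_neq0 // oppr_eq0 pnatr_eq0.
  move=> x xW; rewrite /phi !polarE (cone_sing _ Xu) (polarC12 F x u e); ring.
have T2 x y : x \in W -> y \in W -> T x y e = 0.
  apply: cone_span_polar0 => u v Xu Xv.
  by apply/eqP/negPn/negP => h; apply: H2; exists u, v.
apply: (flag (fun=> 1) x0 id (fun=> 1)) => //.
- by right.
- by exists x0; rewrite // oner_eq0.
- exact: polyfun_coord.
- by move=> x; exists 0, 1; rewrite scale0r scale1r add0r.
- by move=> x _; rewrite scale1r.
- by move=> x xW; apply: T2.
Qed.
End HyperplaneSection.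

(** * The curve is a rational normal quartic *)

(* Where no coordinate vanishes, the singular points of the squarefree cubic
   with coefficients t_ijk become, in the coordinates y_i = 1/x_i, the kernel of
   the symmetric matrix with entry t_ijk at the two indices complementary to
   {i, j, k}. *)
Lemma squarefree_cubic_sing (K : numFieldType)
    (x0 x1 x2 x3 x4 t012 t013 t014 t023 t024 t034 t123 t124 t134 t234 : K) :
  x0 != 0 -> x1 != 0 -> x2 != 0 -> x3 != 0 -> x4 != 0 ->
  t034 != 0 -> t134 != 0 -> t234 != 0 ->
  x1 * x2 * t012 + x1 * x3 * t013 + x1 * x4 * t014
    + x2 * x3 * t023 + x2 * x4 * t024 + x3 * x4 * t034 = 0 ->
  x0 * x2 * t012 + x0 * x3 * t013 + x0 * x4 * t014
    + x2 * x3 * t123 + x2 * x4 * t124 + x3 * x4 * t134 = 0 ->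
  x0 * x1 * t012 + x0 * x3 * t023 + x0 * x4 * t024
    + x1 * x3 * t123 + x1 * x4 * t124 + x3 * x4 * t234 = 0 ->
  x0 * x1 * t013 + x0 * x2 * t023 + x0 * x4 * t034
    + x1 * x2 * t123 + x1 * x4 * t134 + x2 * x4 * t234 = 0 ->
  x0 * x1 * t014 + x0 * x2 * t024 + x0 * x3 * t034
    + x1 * x2 * t124 + x1 * x3 * t134 + x2 * x3 * t234 = 0 ->
  [/\ x0^-1 = - (t134 * t024 + t234 * t014 - t034 * t124) / (2 * t234 * t134) * x3^-1
            - (t134 * t023 + t234 * t013 - t034 * t123) / (2 * t234 * t134) * x4^-1,
      x1^-1 = - (t034 * t124 + t234 * t014 - t134 * t024) / (2 * t234 * t034) * x3^-1
            - (t034 * t123 + t234 * t013 - t134 * t023) / (2 * t234 * t034) * x4^-1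
    & x2^-1 = - (t034 * t124 + t134 * t024 - t234 * t014) / (2 * t134 * t034) * x3^-1
            - (t034 * t123 + t134 * t023 - t234 * t013) / (2 * t134 * t034) * x4^-1].
Proof.
move=> n0 n1 n2 n3 n4 m0 m1 m2 d0 d1 d2 d3 d4.
have two : (2 : K) != 0 by rewrite pnatr_eq0.
have three : (3 : K) != 0 by rewrite pnatr_eq0.
pose G := x0 * x1 * x2 * t012 + x0 * x1 * x3 * t013 + x0 * x1 * x4 * t014
  + x0 * x2 * x3 * t023 + x0 * x2 * x4 * t024 + x0 * x3 * x4 * t034
  + x1 * x2 * x3 * t123 + x1 * x2 * x4 * t124 + x1 * x3 * x4 * t134
  + x2 * x3 * x4 * t234.
have G0 : G = 0.
  apply: (mulfI three); rewrite mulr0.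
  transitivity (x0 * 0 + x1 * 0 + x2 * 0 + x3 * 0 + x4 * 0 : K); last by ring.
  by rewrite -{1}d0 -{1}d1 -{1}d2 -{1}d3 -d4 /G; ring.
have r0 : t234 / x1 + t134 / x2 + t124 / x3 + t123 / x4 = 0.
  transitivity ((G - x0 * 0) / (x1 * x2 * x3 * x4)).
    by rewrite -d0 /G; field; rewrite ?n1 ?n2 ?n3 ?n4.
  by rewrite G0 mulr0 subr0 mul0r.
have r1 : t234 / x0 + t034 / x2 + t024 / x3 + t023 / x4 = 0.
  transitivity ((G - x1 * 0) / (x0 * x2 * x3 * x4)).
    by rewrite -d1 /G; field; rewrite ?n0 ?n2 ?n3 ?n4.
  by rewrite G0 mulr0 subr0 mul0r.
have r2 : t134 / x0 + t034 / x1 + t014 / x3 + t013 / x4 = 0.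
  transitivity ((G - x2 * 0) / (x0 * x1 * x3 * x4)).
    by rewrite -d2 /G; field; rewrite ?n0 ?n1 ?n3 ?n4.
  by rewrite G0 mulr0 subr0 mul0r.
split; apply/eqP; rewrite -subr_eq0; apply/eqP.
- transitivity ((t134 * 0 + t234 * 0 - t034 * 0) / (2 * t234 * t134)).
    by rewrite -{1}r1 -{1}r2 -r0; field; rewrite ?n0 ?n1 ?n2 ?n3 ?n4 ?m0 ?m1 ?m2 ?two.
  by rewrite !mulr0 subr0 addr0 mul0r.
- transitivity ((t034 * 0 + t234 * 0 - t134 * 0) / (2 * t234 * t034)).
    by rewrite -{1}r0 -{1}r2 -r1; field; rewrite ?n0 ?n1 ?n2 ?n3 ?n4 ?m0 ?m1 ?m2 ?two.
  by rewrite !mulr0 subr0 addr0 mul0r.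
transitivity ((t034 * 0 + t134 * 0 - t234 * 0) / (2 * t134 * t034)).
  by rewrite -{1}r0 -{1}r1 -r2; field; rewrite ?n0 ?n1 ?n2 ?n3 ?n4 ?m0 ?m1 ?m2 ?two.
by rewrite !mulr0 subr0 addr0 mul0r.
Qed.

Lemma binary_prod (K : fieldType) (I : Type) (r : seq I) (al be : I -> K) :
  exists q : nat -> K, forall s t, \prod_(j <- r) (al j * s + be j * t) =
    \sum_(k < (size r).+1) q k * (s ^+ (size r - k) * t ^+ k).
Proof.
elim: r => [|i r [q IH]].
  by exists (fun=> 1) => s t; rewrite big_nil big_ord1 !mulr1.
exists (fun k => al i * (if k == (size r).+1 then 0 else q k)
               + be i * (if k is k'.+1 then q k' else 0)) => s t.
rewrite big_cons IH mulrDl /=.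
under [RHS]eq_bigr => k _ do rewrite mulrDl.
rewrite [RHS]big_split /= [X in _ = X + _]big_ord_recr [X in _ = _ + X]big_ord_recl /=.
rewrite eqxx !mulr0 !mul0r addr0 add0r !mulr_sumr; congr (_ + _).
  apply: eq_bigr => k _; rewrite (ltn_eqF (ltn_ord k)) (subSn (leq_ord k)) exprS.
  by ring.
by apply: eq_bigr => k _; rewrite /bump /= add1n subSS exprS; ring.
Qed.

Lemma symmetric_sum5 (K : numFieldType) (c : nat -> K) (B : nat -> nat -> K) :
  (forall i j, B i j = B j i) -> (forall i, (i < 5)%N -> B i i = 0) ->
  \sum_(i < 5) c i * \sum_(j < 5) c j * B i j =
  let t i j := c i * c j * B i j in
  2 * (t 0%N 1%N + t 0%N 2%N + t 0%N 3%N + t 0%N 4%N + t 1%N 2%N + t 1%N 3%N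
     + t 1%N 4%N + t 2%N 3%N + t 2%N 4%N + t 3%N 4%N).
Proof.
move=> sB B0 /=; rewrite !big_ord_recr !big_ord0 /= !B0 //.
rewrite (sB 1%N 0%N) (sB 2 0)%N (sB 3 0)%N (sB 4 0)%N (sB 2 1)%N (sB 3 1)%N.
rewrite (sB 4 1)%N (sB 3 2)%N (sB 4 2)%N (sB 4 3)%N; ring.
Qed.

Section Nondegenerate.
Variables (K : numFieldType) (F : {mpoly K[6]}).
Local Notation vec := 'rV[K]_6.
Local Notation T := (polar F).
Hypothesis Fcubic : F \is 3.-homog.
Variables (C : set (proj_space K 5)) (W : {vspace vec}).
Hypotheses (Cirr : irreducible_closed C) (CW : is_linear_span C W).
Hypotheses (Csing : C `<=` sing_locus F) (dimW : \dim W = 5%N).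
Local Notation X := (cone C).

Lemma cone_basis : (exists x y z, [/\ X x, X y, X z & T x y z != 0]) ->
  exists U : 5.-tuple vec, [/\ basis_of W U, forall i : 'I_5, X U`_i
    & forall i : nat, (i < 3)%N -> T U`_3 U`_4 U`_i != 0].
Proof.
move=> [u3 [u4 [u2 [X3 X4 X2 T342]]]].
have s0 x w : X x -> T x x w = 0 by apply: (cone_sing Fcubic Csing).
pose g := T u3 u4.
have gl a u v : g (a *: u + v) = a * g u + g v by rewrite /g !polarE.
have gS (M : seq vec) : (forall x, x \in M -> g x = 0) ->
    forall x, x \in <<M>>%VS -> g x = 0.
  move=> gM x xM; apply: contrapT => /eqP gx.
  pose fl := GRing.isLinear.Build K vec K^o *%R g gl.
  pose h : {linear vec -> K^o} := HB.pack g fl.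
  have : (<<M>> <= lker (linfun h))%VS.
    by apply/span_subvP => y yM; rewrite memv_ker lfunE /= gM.
  by move=> /subvP/(_ x xM); rewrite memv_ker lfunE /= (negbTE gx).
have g3 : g u3 = 0 by rewrite /g polarC23 s0.
have g4 : g u4 = 0 by rewrite /g polarC12 polarC23 s0.
have dim_lt (s : seq vec) : (size s < 5)%N -> ~~ (W <= <<s>>)%VS.
  move=> s5; apply/negP => /dimvS h; have := leq_trans h (dim_span s).
  by rewrite dimW leqNgt s5.
have hg := hpoly_linear gl.
have gn : exists2 x, X x & g x != 0 by exists u2.
have [u1 X1 /andP [f1 g1]] := cone_avoid Cirr CW (dim_lt [:: u2; u3; u4] isT) hg gn.
have [u0 X0 /andP [f0 g0]] := cone_avoid Cirr CW (dim_lt [:: u1; u2; u3; u4] isT) hg gn.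
exists [tuple u0; u1; u2; u3; u4]; split.
- rewrite basisEfree dimW /= andbT; apply/andP; split; last first.
    apply/span_subvP => x; rewrite !inE.
    by case/or4P => [||| /orP []] /eqP ->; apply: (cone_span CW).
  rewrite /= !free_cons f0 f1 nil_free andbT /= span_nil memv0.
  apply/and3P; split.
  + apply: contraNN T342 => /(gS [:: u3; u4]) h; apply/eqP/h.
    by move=> x; rewrite !inE => /orP [] /eqP ->.
  + rewrite span_seq1; apply: contraNN T342 => /vlineP [a ->].
    by rewrite polarZ1 s0 // mulr0.
  apply: contraNneq T342 => ->.
  by rewrite -(scale0r 0) polarZ2 mul0r.
- by case=> [[|[|[|[|[|]]]]]].
by case=> [|[|[|]]].
Qed.

Section Coordinates.
Variable U : 5.-tuple vec.
Hypotheses (UW : basis_of W U) (XU : forall i : 'I_5, X U`_i).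
Hypothesis TU : forall i : nat, (i < 3)%N -> T U`_3 U`_4 U`_i != 0.
Local Notation c i x := (coord U i x).

Lemma cone_coordE x : X x -> x = \sum_i c i x *: U`_i.
Proof. by move=> Xx; apply: coord_basis UW (cone_span CW Xx). Qed.

Lemma coordU (i j : 'I_5) : c i U`_j = (j == i)%:R.
Proof. exact: coord_free (basis_free UW). Qed.

Lemma polar_quadric x (l : nat) : X x ->
  let c k := c (inord k) x in
  let t i j k := c i * c j * T U`_i U`_j U`_k in
  t 0%N 1%N l + t 0%N 2%N l + t 0%N 3%N l + t 0%N 4%N l + t 1%N 2%N l
    + t 1%N 3%N l + t 1%N 4%N l + t 2%N 3%N l + t 2%N 4%N l + t 3%N 4%N l = 0.
Proof.
move=> Xx /=; have := cone_sing Fcubic Csing (U`_l) Xx.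
rewrite {1 2}(cone_coordE Xx) polar_sum1; under eq_bigr => i _ do rewrite polar_sum2.
have two : (2 : K) != 0 by rewrite pnatr_eq0.
move=> E; have := @symmetric_sum5 K (fun k => c (inord k) x)
  (fun i j => T U`_i U`_j U`_l).
move=> /= H; apply: (mulfI two).
rewrite mulr0 -[RHS]E -[LHS]H.
- apply: eq_bigr => i _; rewrite inord_val; congr (_ * _).
  by apply: eq_bigr => j _; rewrite inord_val.
- by move=> i j; rewrite polarC12.
by move=> i i5; apply: (cone_sing Fcubic Csing); apply: (XU (Ordinal i5)).
Qed.

Lemma torus_kernel : exists al be : 'I_5 -> K,
  forall x, X x -> (forall i, c i x != 0) ->
  exists s t, forall i, (c i x)^-1 = al i * s + be i * t.
Proof.
pose t i j k := T U`_i U`_j U`_k.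
have rot i j k : t i j k = t k i j by rewrite /t polarC23 polarC12.
have swap i j k : t i j k = t i k j by rewrite /t polarC23.
have t0 i j : (i < 5)%N -> t i i j = 0.
  by move=> i5; apply: (cone_sing Fcubic Csing); apply: (XU (Ordinal i5)).
have t0' i j : (i < 5)%N -> t i j i = 0 by move=> i5; rewrite swap t0.
have t0'' i j : (i < 5)%N -> t j i i = 0 by move=> i5; rewrite rot t0'.
have tn i : (i < 3)%N -> t i 3%N 4%N != 0.
  by move=> i3; rewrite -rot TU.
pose m0 := t 0%N 3%N 4%N; pose m1 := t 1%N 3%N 4%N; pose m2 := t 2%N 3%N 4%N.
pose e0 k := - (m1 * t 0%N 2%N k + m2 * t 0%N 1%N k - m0 * t 1%N 2%N k).
pose e1 k := - (m0 * t 1%N 2%N k + m2 * t 0%N 1%N k - m1 * t 0%N 2%N k).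
pose e2 k := - (m0 * t 1%N 2%N k + m1 * t 0%N 2%N k - m2 * t 0%N 1%N k).
pose l k a b := [:: e0 k / (2 * m2 * m1); e1 k / (2 * m2 * m0);
  e2 k / (2 * m1 * m0); a; b].
pose l0 := l 4%N 1 0; pose l1 := l 3%N 0 1.
exists (fun i => nth 0 l0 i), (fun i => nth 0 l1 i) => x Xx cx.
pose x_ k := c (inord k) x.
have xn k : x_ k != 0 by apply: cx.
have q l := polar_quadric l Xx.
have d0 : x_ 1%N * x_ 2%N * t 0%N 1%N 2%N + x_ 1%N * x_ 3%N * t 0%N 1%N 3%N
    + x_ 1%N * x_ 4%N * t 0%N 1%N 4%N + x_ 2%N * x_ 3%N * t 0%N 2%N 3%N
    + x_ 2%N * x_ 4%N * t 0%N 2%N 4%N + x_ 3%N * x_ 4%N * t 0%N 3%N 4%N = 0.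
  rewrite -(q 0%N) -![T _ _ _]/(t _ _ _) !t0' // (rot 1 2 0)%N (rot 1 3 0)%N.
  by rewrite (rot 1 4 0)%N (rot 2 3 0)%N (rot 2 4 0)%N (rot 3 4 0)%N /x_; ring.
have d1 : x_ 0%N * x_ 2%N * t 0%N 1%N 2%N + x_ 0%N * x_ 3%N * t 0%N 1%N 3%N
    + x_ 0%N * x_ 4%N * t 0%N 1%N 4%N + x_ 2%N * x_ 3%N * t 1%N 2%N 3%N
    + x_ 2%N * x_ 4%N * t 1%N 2%N 4%N + x_ 3%N * x_ 4%N * t 1%N 3%N 4%N = 0.
  rewrite -(q 1%N) -![T _ _ _]/(t _ _ _) !t0' // !t0'' // (swap 0 2 1)%N (swap 0 3 1)%N.
  by rewrite (swap 0 4 1)%N (rot 2 3 1)%N (rot 2 4 1)%N (rot 3 4 1)%N /x_; ring.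
have d2 : x_ 0%N * x_ 1%N * t 0%N 1%N 2%N + x_ 0%N * x_ 3%N * t 0%N 2%N 3%N
    + x_ 0%N * x_ 4%N * t 0%N 2%N 4%N + x_ 1%N * x_ 3%N * t 1%N 2%N 3%N
    + x_ 1%N * x_ 4%N * t 1%N 2%N 4%N + x_ 3%N * x_ 4%N * t 2%N 3%N 4%N = 0.
  rewrite -(q 2%N) -![T _ _ _]/(t _ _ _) !t0' // !t0'' // (swap 0 3 2)%N (swap 0 4 2)%N.
  by rewrite (swap 1 3 2)%N (swap 1 4 2)%N (rot 3 4 2)%N /x_; ring.
have d3 : x_ 0%N * x_ 1%N * t 0%N 1%N 3%N + x_ 0%N * x_ 2%N * t 0%N 2%N 3%N
    + x_ 0%N * x_ 4%N * t 0%N 3%N 4%N + x_ 1%N * x_ 2%N * t 1%N 2%N 3%N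
    + x_ 1%N * x_ 4%N * t 1%N 3%N 4%N + x_ 2%N * x_ 4%N * t 2%N 3%N 4%N = 0.
  rewrite -(q 3%N) -![T _ _ _]/(t _ _ _) !t0' // !t0'' // (swap 0 4 3)%N (swap 1 4 3)%N.
  by rewrite (swap 2 4 3)%N /x_; ring.
have d4 : x_ 0%N * x_ 1%N * t 0%N 1%N 4%N + x_ 0%N * x_ 2%N * t 0%N 2%N 4%N
    + x_ 0%N * x_ 3%N * t 0%N 3%N 4%N + x_ 1%N * x_ 2%N * t 1%N 2%N 4%N
    + x_ 1%N * x_ 3%N * t 1%N 3%N 4%N + x_ 2%N * x_ 3%N * t 2%N 3%N 4%N = 0.
  by rewrite -(q 4%N) -![T _ _ _]/(t _ _ _) !t0'' // /x_; ring.
have [y0 y1 y2] := squarefree_cubic_sing (xn 0%N) (xn 1%N) (xn 2%N) (xn 3%N)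
  (xn 4%N) (tn 0%N isT) (tn 1%N isT) (tn 2%N isT) d0 d1 d2 d3 d4.
exists (x_ 3%N)^-1, (x_ 4%N)^-1 => i.
rewrite -[in c i x](inord_val i) -/(x_ i).
case: i => [[|[|[|[|[|//]]]]] _] /=.
- by rewrite y0 /e0 -/m0 -/m1 -/m2; ring.
- by rewrite y1 /e1 -/m0 -/m1 -/m2; ring.
- by rewrite y2 /e2 -/m0 -/m1 -/m2; ring.
- by rewrite mul1r mul0r addr0.
by rewrite mul1r mul0r add0r.
Qed.

Lemma hpoly_coord i : hpoly (fun x => c i x).
Proof. by apply: hpoly_linear => a u v; rewrite linearP. Qed.

Lemma torus_pick g : hpoly g -> (exists2 v, X v & g v != 0) ->
  exists x, [/\ X x, forall i, c i x != 0 & g x != 0].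
Proof.
move=> hg gn.
have cn (i : 'I_5) : exists2 v, X v & c i v != 0.
  by exists U`_i => //; rewrite coordU eqxx oner_eq0.
have [|||x Xx] := @hpoly_pick_prod _ _ _ Cirr (option 'I_5)
    (None :: map some (enum 'I_5)) (fun o x => if o is Some i then c i x else g x).
- by case: gn => v Xv _; exists v.
- by case=> [i|] _ //; apply: hpoly_coord.
- by case=> [i|] _ //; apply: cn.
move=> h; exists x; split=> // [i|]; last by apply: (h None); rewrite mem_head.
by apply: (h (Some i)); rewrite inE map_f ?mem_enum // orbT.
Qed.

Variables al be : 'I_5 -> K.
Hypothesis kerX : forall x, X x -> (forall i, c i x != 0) ->
  exists s t, forall i, (c i x)^-1 = al i * s + be i * t.

Local Notation d i j := (al i * be j - al j * be i).

Lemma pencil_det_neq0 i j : i != j -> d i j != 0.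
Proof.
move=> ij; apply/negP => /eqP d0.
have lin a b : hpoly (fun x => a * c i x + b * c j x).
  by apply: hpoly_linear => k u v; rewrite !linearP /=; ring.
have nz a b : (a != 0) || (b != 0) ->
    exists2 v, X v & a * c i v + b * c j v != 0.
  case/orP => h; [exists U`_i|exists U`_j] => //; rewrite !coordU eqxx.
    by rewrite (negbTE ij) mulr0 addr0 mulr1.
  by rewrite [j == i]eq_sym (negbTE ij) mulr0 add0r mulr1.
have prop a b : (forall s t, a * (al j * s + be j * t) + b * (al i * s + be i * t) = 0) ->
    ~~ ((a != 0) || (b != 0)).
  move=> ab; apply/negP => /nz /(torus_pick (lin _ _)) [x [Xx cx]].
  have [s [t E]] := kerX Xx cx; have := ab s t; rewrite -!E => ab0.
  have -> : a * c i x + b * c j x = c i x * c j x * (a * (c j x)^-1 + b * (c i x)^-1).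
    by field; rewrite !cx.
  by rewrite ab0 mulr0 eqxx.
have a0 : ~~ ((al i != 0) || (- al j != 0)).
  by apply: prop => s t; transitivity (d i j * t); [ring|rewrite d0 mul0r].
have b0 : ~~ ((be i != 0) || (- be j != 0)).
  by apply: prop => s t; transitivity (- d i j * s); [ring|rewrite d0 oppr0 mul0r].
have n11 : (1 != 0 :> K) || (1 != 0 :> K) by rewrite oner_neq0.
have [x [Xx cx _]] := torus_pick (lin 1 1) (nz 1 1 n11).
have [s [t E]] := kerX Xx cx; have := invr_neq0 (cx i).
move: a0 b0; rewrite !negb_or !negbK E => /andP [/eqP -> _] /andP [/eqP -> _].
by rewrite !mul0r addr0 eqxx.
Qed.

Lemma cone_quadric i j k x : X x ->
  d j k * (c j x * c k x) + d k i * (c i x * c k x) + d i j * (c i x * c j x) = 0.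
Proof.
pose q (x : vec) :=
  d j k * (c j x * c k x) + d k i * (c i x * c k x) + d i j * (c i x * c j x).
have hq : hpoly q.
  have cE m : exists P : {mpoly K[6]}, P \is 1.-homog /\ forall v, c m v = ev P v.
    have [|P hP fP] := @linear_mpoly K 5 (fun x => c m x); last by exists P.
    by move=> a u v; rewrite linearP.
  have /fin_all_exists [P hP] := cE.
  have hPP m m' : P m * P m' \is 2.-homog.
    by apply: (@dhomogM _ _ _ 1 _ 1); [case: (hP m)|case: (hP m')].
  exists 2%N, (d j k *: (P j * P k) + d k i *: (P i * P k) + d i j *: (P i * P j)).
  split; first by apply: rpredD; [apply: rpredD|]; apply: rpredZ; apply: hPP.
  move=> v; rewrite /q (hP i).2 (hP j).2 (hP k).2.
  by rewrite /ev !mevalD !mevalZ !mevalM.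
move=> Xx; apply: contrapT => /eqP qx.
have [|y [Xy cy]] := torus_pick hq; first by exists x.
have [s [t E]] := kerX Xy cy; move/negP; apply; apply/eqP.
rewrite /q; transitivity (c i y * c j y * c k y *
  (d j k * (c i y)^-1 + d k i * (c j y)^-1 + d i j * (c k y)^-1)).
  by field; rewrite !cy.
by rewrite !E; ring.
Qed.

Lemma cone_param x : X x -> x != 0 -> exists s t k,
  [/\ (s != 0) || (t != 0), k != 0 &
    forall i, c i x = k * \prod_(j | j != i) (al j * s + be j * t)].
Proof.
move=> Xx xn; have [/forallP cx|nx] := boolP [forall i, c i x != 0].
  have [s [t E]] := kerX Xx cx; exists s, t, (\prod_j c j x); split.
  - apply/negPn/negP; rewrite negb_or !negbK => /andP [/eqP s0 /eqP t0].
    by have := invr_neq0 (cx ord0); rewrite E s0 t0 !mulr0 addr0 eqxx.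
  - by apply/prodf_neq0 => i _.
  move=> i; rewrite (bigD1 i) //= -mulrA -big_split /= big1 ?mulr1 // => j _.
  by rewrite -E mulfV.
have [i /negPn/eqP ci] : exists i, ~~ (c i x != 0).
  by apply/existsP; rewrite -negb_forall.
have [j cj] : exists j, c j x != 0.
  apply/existsP; rewrite -negb_forall; apply: contraNN xn => /forallP h.
  rewrite (cone_coordE Xx) big1 // => j _.
  by rewrite (eqP (h j)) scale0r.
have ij : i != j by apply: contraNneq cj => <-; rewrite ci.
have ck k : k != j -> c k x = 0.
  move=> kj; have := cone_quadric i j k Xx; rewrite ci !mul0r !mulr0 !addr0.
  have [->//|ki] := eqVneq k i.
  move/eqP; rewrite !mulf_eq0 (negbTE cj) /= => /orP [/eqP h|/eqP //].
  by have := pencil_det_neq0 kj; rewrite -oppr_eq0 opprB h eqxx.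
have pn : \prod_(l | l != j) (al l * be j + be l * - al j) != 0.
  apply/prodf_neq0 => l lj; have := pencil_det_neq0 lj.
  by rewrite mulrN (mulrC (be l)).
exists (be j), (- al j), (c j x / \prod_(l | l != j) (al l * be j + be l * - al j)).
split.
- apply: contraNT (pencil_det_neq0 ij).
  rewrite negb_or oppr_eq0 !negbK => /andP [/eqP -> /eqP ->].
  by rewrite mulr0 mul0r subrr.
- by rewrite mulf_neq0 // invr_eq0.
move=> k; have [->|kj] := eqVneq k j; first by rewrite divfK.
rewrite ck // [X in _ * X](bigD1 j) /= 1?eq_sym //.
have -> : al j * be j + be j * - al j = 0 by ring.
by rewrite mul0r mulr0.
Qed.

Lemma veronese_frame : exists A : 'M[K]_(5, 6),
  [/\ row_free A, forall w, w \in W <-> exists z : 'rV_5, w = z *m A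
    & forall x, X x -> x != 0 -> exists st k,
      [/\ st != 0, k != 0 & x = k *: (veronese 4 st *m A)]].
Proof.
pose M := \matrix_(i < 5) U`_i.
have ME (z : 'rV_5) : z *m M = \sum_i z 0 i *: U`_i.
  by rewrite mulmx_sum_row; apply: eq_bigr => i _; rewrite rowK.
have Minj (z : 'rV_5) : z *m M = 0 -> z = 0.
  rewrite ME => z0; apply/rowP => i; rewrite mxE.
  have := congr1 (fun v => c i v) z0; rewrite /= linear0 linear_sum /=.
  rewrite (bigD1 i) //= linearZ /= coordU eqxx mulr1 big1 ?addr0 // => j ji.
  by rewrite linearZ /= coordU (negbTE ji) mulr0.
have qE (i : 'I_5) : exists q : nat -> K, forall s t : K,
    \prod_(j | j != i) (al j * s + be j * t) =
    \sum_(k < 5) q k * (s ^+ (4 - k) * t ^+ k).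
  have [q qE] := binary_prod (enum (predC1 i)) al be.
  exists q => s t; rewrite -big_enum qE -cardE cardC1 card_ord.
  by [].
have /fin_all_exists [q {}qE] := qE.
pose P := \matrix_(k < 5, i < 5) q i k.
have verP st i : (veronese 4 st *m P) 0 i =
    \prod_(j | j != i) (al j * st 0 0 + be j * st 0 1).
  by rewrite qE mxE; apply: eq_bigr => k _; rewrite !mxE mulrC.
pose pt j : 'rV[K]_2 := \row_(k < 2) (if k == 0 then be j else - al j).
pose V := \matrix_(j < 5) veronese 4 (pt j).
have VP : V *m P = diag_mx (\row_j \prod_(l | l != j) (al l * be j + be l * - al j)).
  apply/matrixP => j i; rewrite [RHS]mxE [X in X *+ _]mxE.
  have -> : (V *m P) j i = (veronese 4 (pt j) *m P) 0 i.
    by rewrite !mxE; apply: eq_bigr => k _; rewrite !mxE.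
  rewrite verP !mxE /=; have [->|ji] := eqVneq j i; first by rewrite mulr1n.
  rewrite (bigD1 j) //= (_ : al j * be j + be j * - al j = 0) ?mul0r //; ring.
have Pu : P \in unitmx.
  suff : V *m P \in unitmx by rewrite unitmx_mul => /andP [].
  rewrite VP unitmxE det_diag unitfE; apply/prodf_neq0 => j _; rewrite mxE.
  apply/prodf_neq0 => l lj; have := pencil_det_neq0 lj.
  by rewrite mulrN (mulrC (be l)).
exists (P *m M); split.
- apply: inj_row_free => z; rewrite mulmxA => /Minj /(congr1 (mulmx^~ (invmx P))).
  by rewrite mulmxK // mul0mx.
- move=> w; split=> [wW|[z ->]].
    exists ((\row_i c i w) *m invmx P); rewrite mulmxA mulmxKV // ME.
    rewrite {1}(coord_basis UW wW); apply: eq_bigr => i _; by rewrite mxE.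
  rewrite mulmxA ME; apply: rpred_sum => i _; apply: memvZ.
  exact: (cone_span CW).
move=> x Xx xn; have [s [t [k [stn kn E]]]] := cone_param Xx xn.
pose st : 'rV[K]_2 := \row_(i < 2) (if i == 0 then s else t).
exists st, k; split=> //.
  apply: contraTneq stn => st0; rewrite negb_or !negbK.
  have := congr1 (fun m : 'rV_2 => m 0 0) st0.
  have := congr1 (fun m : 'rV_2 => m 0 1) st0.
  by rewrite !mxE /= => -> ->; rewrite eqxx.
rewrite mulmxA ME scaler_sumr {1}(cone_coordE Xx); apply: eq_bigr => i _.
by rewrite scalerA E verP !mxE.
Qed.
End Coordinates.
End Nondegenerate.

Lemma roots_finite (K : fieldType) (p : {poly K}) : p != 0 ->
  exists s : seq K, forall x, root p x -> x \in s.
Proof.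
have [m] := ubnP (size p); elim: m p => // m IH p pm pn.
have [[a pa]|H] := pselect (exists a, root p a); last first.
  by exists [::] => x px; case: H; exists x.
have [q E] := factor_theorem _ _ pa.
have qn : q != 0 by apply: contraNneq pn => q0; rewrite E q0 mul0r.
have [|s hs] := IH q _ qn.
  by move: pm; rewrite E size_Mmonic ?monicXsubC // size_XsubC addn2 ltnS.
exists (a :: s) => x; rewrite E rootM root_XsubC inE => /orP [/hs ->|->] //.
by rewrite orbT.
Qed.

Section VeroneseCone.
Variables (K : numFieldType) (C : set (proj_space K 5)) (W : {vspace 'rV[K]_6}).
Hypotheses (Cirr : irreducible_closed C) (CW : is_linear_span C W).
Local Notation X := (cone C).
Variable A : 'M[K]_(5, 6).
Hypothesis Afree : row_free A.
Hypothesis AW : forall w, w \in W <-> exists z : 'rV_5, w = z *m A.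
Hypothesis AX : forall x, X x -> x != 0 -> exists st k,
  [/\ st != 0, k != 0 & x = k *: (veronese 4 st *m A)].

Definition pair_row (s t : K) : 'rV[K]_2 := \row_i (if i == 0 then s else t).

Lemma pair_rowE (st : 'rV[K]_2) : st = pair_row (st 0 0) (st 0 1).
Proof.
by apply/rowP => -[[|[|//]] h]; rewrite mxE; congr (st _ _); apply: val_inj.
Qed.

Lemma veroneseE d s t k : veronese d (pair_row s t) 0 k = s ^+ (d - k) * t ^+ k.
Proof. by rewrite !mxE. Qed.

Lemma veronese_scale d a s t :
  veronese d (pair_row (a * s) (a * t)) = a ^+ d *: veronese d (pair_row s t).
Proof.
apply/rowP => k; rewrite [RHS]mxE !veroneseE !exprMn.
have -> : a ^+ d = a ^+ (d - k) * a ^+ k by rewrite -exprD subnK // leq_ord.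
by ring.
Qed.

Lemma ev_veronese_poly (P : {mpoly K[6]}) (a b c e : K) :
  exists h : {poly K}, forall r,
    h.[r] = ev P (veronese 4 (pair_row (a + b * r) (c + e * r)) *m A).
Proof.
pose p i : {poly K} := \sum_(k < 5)
  (a%:P + b *: 'X) ^+ (4 - k) * (c%:P + e *: 'X) ^+ k * (A k i)%:P.
exists (\sum_(m <- msupp P) P@_m *: \prod_i p i ^+ m i) => r.
rewrite horner_sum /ev mevalE; apply: eq_bigr => m _.
rewrite hornerZ horner_prod; congr (_ * _); apply: eq_bigr => i _.
rewrite horner_exp; congr (_ ^+ _); rewrite horner_sum mxE.
by apply: eq_bigr => k _; rewrite veroneseE !hornerE.
Qed.

Lemma veronese_neq0 d st : st != 0 -> veronese d st != 0 :> 'rV[K]_d.+1.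
Proof.
apply: contraNneq => v0; rewrite [st]pair_rowE in v0 *.
have s0 := congr1 (fun v : 'rV_d.+1 => v 0 ord0) v0.
have t0 := congr1 (fun v : 'rV_d.+1 => v 0 ord_max) v0.
move: s0 t0; rewrite !veroneseE [in X in X -> _]mxE [in X in _ -> X -> _]mxE.
rewrite subn0 subnn !expr0 mulr1 mul1r => /eqP s0 /eqP t0.
apply/eqP/rowP => i; rewrite !mxE; move: s0 t0; rewrite !expf_eq0.
by case: ifP => _ /andP [_ /eqP s0] /andP [_ /eqP t0].
Qed.

Lemma veronese_frame_neq0 st : st != 0 -> veronese 4 st *m A != 0.
Proof.
move=> /(veronese_neq0 4); apply: contraNneq => vA0.
have := congr1 (mulmx^~ (pinvmx A)) vA0.
by rewrite -mulmxA mulmxVp // mulmx1 mul0mx => ->.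
Qed.

Lemma veronese_cone st : st != 0 -> X (veronese 4 st *m A).
Proof.
move=> stn; apply: (cone_closed Cirr); first exact: veronese_frame_neq0.
move=> d P hP PX.
pose z (k : 'I_5) (x : 'rV[K]_6) := (x *m pinvmx A) 0 k.
have zlin k a u v : z k (a *: u + v) = a * z k u + z k v.
  by rewrite /z mulmxDl -scalemxAl !mxE.
have zA k (y : 'rV_5) : z k (y *m A) = y 0 k.
  by rewrite /z -mulmxA mulmxVp // mulmx1.
have zX (f : 'rV[K]_6 -> K) (y : 'rV_5) :
    (forall a u v, f (a *: u + v) = a * f u + f v) -> f (y *m A) != 0 ->
    exists2 v, X v & f v != 0.
  move=> lf; apply: contraPP => H; apply/negP; rewrite negbK; apply/eqP.
  apply: (linear_span_eq0 CW lf) => [v Xv|]; last by apply/AW; exists y.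
  by apply/eqP/negPn/negP => h; apply: H; exists v.
have [h1 h1E] := ev_veronese_poly P 1 0 0 1.
have {}h1E r : h1.[r] = ev P (veronese 4 (pair_row 1 r) *m A).
  by rewrite h1E mul0r addr0 add0r mul1r.
have evh s t : s != 0 ->
    ev P (veronese 4 (pair_row s t) *m A) = (s ^+ 4) ^+ d * h1.[t / s].
  move=> sn; rewrite h1E -(ev_homogZ _ _ hP) scalemxAl -veronese_scale mulr1.
  by rewrite mulrC divfK.
have h10 : h1 = 0.
  apply/eqP/negPn/negP => /roots_finite [rs hrs].
  pose f (o : option K) x := if o is Some r then z 1 x - r * z 0 x else z 0 x.
  have flin o a u v : f o (a *: u + v) = a * f o u + f o v.
    by case: o => [r|] /=; rewrite !zlin //; ring.
  have [|||x Xx fx] := @hpoly_pick_prod _ _ _ Cirr (option K) (None :: map some rs) f.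
  - case: Cirr => _ [p Cp] _; have [v _ pv] := proj_lineP p.
    by exists v, p; rewrite pv memv_line.
  - by move=> o _; apply: hpoly_linear.
  - move=> [r|] _.
      apply: (zX _ (delta_mx 0 1)) => //.
      by rewrite /= !zA !mxE /= mulr0 subr0 oner_eq0.
    by apply: (zX _ (delta_mx 0 0)) => //; rewrite /= !zA !mxE /= oner_eq0.
  have z0 : z 0 x != 0 by apply: (fx None); rewrite mem_head.
  have xn : x != 0 by apply: contraNneq z0 => ->; rewrite /z mul0mx mxE.
  have [st' [k [_ kn xE]]] := AX Xx xn.
  move: xE; rewrite [st']pair_rowE; set s := st' 0 0; set t := st' 0 1 => xE.
  have zE j : z j x = k * (s ^+ (4 - j) * t ^+ j).
    by rewrite xE scalemxAl zA mxE veroneseE.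
  have sn : s != 0 by apply: contraNneq z0 => s0; rewrite zE s0 expr0n mul0r mulr0.
  have := PX x Xx; rewrite xE (ev_homogZ _ _ hP) evh // => /eqP.
  rewrite !mulf_eq0 !expf_eq0 (negbTE kn) (negbTE sn) !andbF /= => rt.
  have := fx (Some (t / s)); rewrite inE map_f ?orbT; last exact: hrs.
  move=> /(_ isT); rewrite /= !zE /= => /negP; apply; apply/eqP.
  by rewrite subn0 expr0 expr1; field.
rewrite [st]pair_rowE; set s := st 0 0; set t := st 0 1.
have [s0|sn] := eqVneq s 0; last by rewrite evh // h10 horner0 mulr0.
have [h2 h2E] := ev_veronese_poly P 0 1 t 0.
have {}h2E r : h2.[r] = ev P (veronese 4 (pair_row r t) *m A).
  by rewrite h2E mul0r addr0 add0r mul1r.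
rewrite s0 -h2E (poly_eq0_horner (p := h2)) ?horner0 // => r rn.
by rewrite h2E evh // h10 horner0 mulr0.
Qed.

Lemma veronese_rational_normal : rational_normal_curve 4 C.
Proof.
exists A; split=> // p; split=> [Cp|[st [stn pst]]]; last first.
  by apply/(cone_mem C (veronese_frame_neq0 stn) pst); apply: veronese_cone.
have [v vn pv] := proj_lineP p.
have [st [k [stn kn vE]]] := AX ((cone_mem C vn pv).1 Cp) vn.
exists st; split=> //; rewrite pv; apply/eqP.
rewrite eqEdim !dim_vline vn veronese_frame_neq0 // andbT -memvE vE.
by rewrite memvZ ?memv_line.
Qed.

End VeroneseCone.

(** * Cubics singular along the quartic *)

Lemma veronese_quadric_coef (K : numFieldType) (B : nat -> nat -> K) :
  (forall i j, B i j = B j i) ->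
  (forall t, \sum_(i < 5) t ^+ i * \sum_(j < 5) t ^+ j * B i j = 0) ->
  [/\ B 0%N 0%N = 0, B 0%N 1%N = 0, B 3%N 4%N = 0 & B 4%N 4%N = 0] /\
  [/\ B 1%N 1%N = - 2 * B 0%N 2%N, B 1%N 2%N = - B 0%N 3%N,
      B 2%N 2%N = - 2 * B 0%N 4%N - 2 * B 1%N 3%N, B 2%N 3%N = - B 1%N 4%N
    & B 3%N 3%N = - 2 * B 2%N 4%N].
Proof.
move=> sB H.
have two : (2 : K) != 0 by rewrite pnatr_eq0.
pose cs := [:: B 0%N 0%N; 2 * B 0%N 1%N; 2 * B 0%N 2%N + B 1%N 1%N;
  2 * B 0%N 3%N + 2 * B 1%N 2%N; 2 * B 0%N 4%N + 2 * B 1%N 3%N + B 2%N 2%N;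
  2 * B 1%N 4%N + 2 * B 2%N 3%N; 2 * B 2%N 4%N + B 3%N 3%N;
  2 * B 3%N 4%N; B 4%N 4%N].
pose p := Poly cs.
have p0 : p = 0.
  apply: poly_eq0_horner => t _; rewrite horner_Poly -(H t) /=.
  rewrite !big_ord_recr !big_ord0 /= (sB 1%N 0%N) (sB 2 0)%N (sB 3 0)%N (sB 4 0)%N.
  rewrite (sB 2 1)%N (sB 3 1)%N (sB 4 1)%N (sB 3 2)%N (sB 4 2)%N (sB 4 3)%N; ring.
have pE k : nth 0 cs k = 0.
  by rewrite -coef_Poly -/p p0 coef0.
have g (x : K) : 2 * x = 0 -> x = 0 by move=> /eqP; rewrite mulf_eq0 (negbTE two) => /eqP.
have h (x y : K) : 2 * x + 2 * y = 0 -> y = - x.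
  rewrite -mulrDr => /g xy; apply/eqP.
  by rewrite -addr_eq0 addrC xy.
have u (x y : K) : 2 * x + y = 0 -> y = - 2 * x.
  by move=> xy; apply/eqP; rewrite mulNr -addr_eq0 addrC xy.
split; split.
- exact: (pE 0%N).
- exact/g/(pE 1%N).
- exact/g/(pE 7%N).
- exact: (pE 8%N).
- exact/u/(pE 2%N).
- exact/h/(pE 3%N).
- rewrite mulNr -opprD -mulrDr -mulNr; apply: u.
  by rewrite mulrDr; apply: (pE 4%N).
- exact/h/(pE 5%N).
- exact/u/(pE 6%N).
Qed.

Lemma veronese_quadric_sum (K : numFieldType) (B : nat -> nat -> K) (z : nat -> K) :
  (forall i j, B i j = B j i) ->
  (forall t, \sum_(i < 5) t ^+ i * \sum_(j < 5) t ^+ j * B i j = 0) ->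
  \sum_(i < 5) z i * \sum_(j < 5) z j * B i j =
  2 * (B 0%N 2%N * (z 0%N * z 2%N - z 1%N ^+ 2)
     + B 0%N 3%N * (z 0%N * z 3%N - z 1%N * z 2%N)
     + B 0%N 4%N * (z 0%N * z 4%N - z 2%N ^+ 2)
     + B 1%N 3%N * (z 1%N * z 3%N - z 2%N ^+ 2)
     + B 1%N 4%N * (z 1%N * z 4%N - z 2%N * z 3%N)
     + B 2%N 4%N * (z 2%N * z 4%N - z 3%N ^+ 2)).
Proof.
move=> sB /(veronese_quadric_coef sB) [[b00 b01 b34 b44] [b11 b12 b22 b23 b33]].
rewrite !big_ord_recr !big_ord0 /= (sB 1%N 0%N) (sB 2 0)%N (sB 3 0)%N (sB 4 0)%N.
rewrite (sB 2 1)%N (sB 3 1)%N (sB 4 1)%N (sB 3 2)%N (sB 4 2)%N (sB 4 3)%N.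
by rewrite b00 b01 b34 b44 b11 b12 b22 b23 b33; ring.
Qed.

Definition hankel (K : comRingType) (z : nat -> K) : K :=
  z 0%N * z 2%N * z 4%N + 2 * (z 1%N * z 2%N * z 3%N) - z 2%N ^+ 3
  - z 0%N * z 3%N ^+ 2 - z 1%N ^+ 2 * z 4%N.

Section NormalFormOnFrame.
Variables (K : numFieldType) (F : {mpoly K[6]}).
Local Notation vec := 'rV[K]_6.
Local Notation T := (polar F).
Variable f : nat -> vec.
Local Notation pt z := (\sum_(i < 5) z i *: f i).
Hypothesis fT : forall t w, T (pt (fun i => t ^+ i)) (pt (fun i => t ^+ i)) w = 0.

Lemma frame_polarE (z : nat -> K) w :
  T (pt z) (pt z) w = \sum_(i < 5) z i * \sum_(j < 5) z j * T (f i) (f j) w.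
Proof. by rewrite polar_sum1; apply: eq_bigr => i _; rewrite polar_sum2. Qed.

Lemma frame_quadric (z : nat -> K) w : let B i j := T (f i) (f j) w in
  T (pt z) (pt z) w =
  2 * (B 0%N 2%N * (z 0%N * z 2%N - z 1%N ^+ 2)
     + B 0%N 3%N * (z 0%N * z 3%N - z 1%N * z 2%N)
     + B 0%N 4%N * (z 0%N * z 4%N - z 2%N ^+ 2)
     + B 1%N 3%N * (z 1%N * z 3%N - z 2%N ^+ 2)
     + B 1%N 4%N * (z 1%N * z 4%N - z 2%N * z 3%N)
     + B 2%N 4%N * (z 2%N * z 4%N - z 3%N ^+ 2)).
Proof.
move=> B; rewrite frame_polarE -/B; apply: veronese_quadric_sum => [i j|t].
  by rewrite /B polarC12.
by rewrite -[RHS](fT t w) frame_polarE.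
Qed.

Local Notation h := (T (f 0%N) (f 2%N) (f 4%N)).

Lemma frame_quadric_frame (z : nat -> K) :
  [/\ T (pt z) (pt z) (f 0%N) = 2 * h * (z 2%N * z 4%N - z 3%N ^+ 2),
      T (pt z) (pt z) (f 1%N) = - 4 * h * (z 1%N * z 4%N - z 2%N * z 3%N),
      T (pt z) (pt z) (f 2%N) =
        2 * h * (z 0%N * z 4%N - z 2%N ^+ 2 + 2 * (z 1%N * z 3%N - z 2%N ^+ 2)),
      T (pt z) (pt z) (f 3%N) = - 4 * h * (z 0%N * z 3%N - z 1%N * z 2%N)
    & T (pt z) (pt z) (f 4%N) = 2 * h * (z 0%N * z 2%N - z 1%N ^+ 2)].
Proof.
pose t i j k := T (f i) (f j) (f k).
have rot i j k : t i j k = t k i j by rewrite /t polarC23 polarC12.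
have swap i j k : t i j k = t i k j by rewrite /t polarC23.
have sw12 i j k : t i j k = t j i k by rewrite /t polarC12.
have R k : [/\ t 0%N 0%N k = 0, t 0%N 1%N k = 0, t 3%N 4%N k = 0 & t 4%N 4%N k = 0] /\
  [/\ t 1%N 1%N k = - 2 * t 0%N 2%N k, t 1%N 2%N k = - t 0%N 3%N k,
      t 2%N 2%N k = - 2 * t 0%N 4%N k - 2 * t 1%N 3%N k, t 2%N 3%N k = - t 1%N 4%N k
    & t 3%N 3%N k = - 2 * t 2%N 4%N k].
  apply: (veronese_quadric_coef (B := fun i j => t i j k)) => [i j|c].
    exact: sw12.
  by rewrite -[RHS](fT c (f k)) frame_polarE.
have t00 k : t 0%N 0%N k = 0 by case: (R k) => -[].
have t01 k : t 0%N 1%N k = 0 by case: (R k) => -[].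
have t34 k : t 3%N 4%N k = 0 by case: (R k) => -[].
have t44 k : t 4%N 4%N k = 0 by case: (R k) => -[].
have t11 k : t 1%N 1%N k = - 2 * t 0%N 2%N k by case: (R k) => _ [].
have t12 k : t 1%N 2%N k = - t 0%N 3%N k by case: (R k) => _ [].
have t22 k : t 2%N 2%N k = - 2 * t 0%N 4%N k - 2 * t 1%N 3%N k by case: (R k) => _ [].
have t33 k : t 3%N 3%N k = - 2 * t 2%N 4%N k by case: (R k) => _ [].
have E012 : t 0%N 2%N 1%N = 0 by rewrite swap t01.
have E034 : t 0%N 3%N 4%N = 0 by rewrite -rot t34.
have E013 : t 0%N 3%N 1%N = 0 by rewrite swap t01.
have E014 : t 0%N 4%N 1%N = 0 by rewrite swap t01.
have E022 : t 0%N 2%N 2%N = 0.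
  have : - 2 * t 0%N 2%N 2%N = 0 by rewrite -t11 swap t12 E013 oppr0.
  by move=> /eqP; rewrite mulf_eq0 oppr_eq0 pnatr_eq0 => /eqP.
have E124 : t 1%N 2%N 4%N = 0 by rewrite t12 E034 oppr0.
have E023 : t 0%N 2%N 3%N = 0.
  have e1 : t 1%N 2%N 2%N = - t 0%N 2%N 3%N by rewrite t12 swap.
  have e2 : t 1%N 2%N 2%N = 4 * t 0%N 2%N 3%N.
    rewrite -rot t22 E014 (swap 1 3 1)%N t11; ring.
  have : 5 * t 0%N 2%N 3%N = 0.
    transitivity (4 * t 0%N 2%N 3%N - - t 0%N 2%N 3%N); first ring.
    by rewrite -e1 -e2 subrr.
  by move=> /eqP; rewrite mulf_eq0 pnatr_eq0 => /eqP.
have E033 : t 0%N 3%N 3%N = - 2 * h by rewrite -(rot 3 3 0)%N t33 (rot 2 4 0)%N.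
have E113 : t 1%N 1%N 3%N = 0 by rewrite t11 E023 mulr0.
have E133 : t 1%N 3%N 3%N = 0 by rewrite -(rot 3 3 1)%N t33 (rot 2 4 1)%N E124 mulr0.
have E123 : t 1%N 2%N 3%N = 2 * h by rewrite t12 E033; ring.
have E114 : t 1%N 1%N 4%N = - 2 * h by rewrite t11.
have E224 : t 2%N 2%N 4%N = 0.
  by rewrite t22 -(rot 4 4 0)%N t44 -(rot 3 4 1)%N t34; ring.
split; rewrite frame_quadric -![T _ _ _]/(t _ _ _).
- rewrite (rot 0 2 0)%N (rot 0 3 0)%N (rot 0 4 0)%N !t00 (rot 1 3 0)%N (rot 1 4 0)%N !t01.
  by rewrite (rot 2 4 0)%N; ring.
- rewrite E012 E013 E014 (swap 1 3 1)%N E113 (swap 1 4 1)%N E114 (rot 2 4 1)%N E124.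
  by rewrite /t; ring.
- rewrite E022 (swap 0 3 2)%N E023 (swap 0 4 2)%N (swap 1 3 2)%N E123 (swap 1 4 2)%N E124.
  by rewrite (swap 2 4 2)%N E224 /t; ring.
- rewrite E023 E033 (swap 0 4 3)%N E034 E133 (swap 1 4 3)%N -(rot 3 4 1)%N.
  by rewrite (swap 2 4 3)%N -(rot 3 4 2)%N !t34 /t; ring.
rewrite E034 -(rot 4 4 0)%N -(rot 3 4 1)%N t34 -(rot 4 4 1)%N -(rot 4 4 2)%N !t44.
by rewrite /t; ring.
Qed.

Lemma frame_cubic (z : nat -> K) :
  T (pt z) (pt z) (pt z) = 6 * (h * hankel z).
Proof.
have := frame_quadric_frame z; set p := pt z => -[e0 e1 e2 e3 e4].
rewrite {3}/p polar_sum3 !big_ord_recr big_ord0 /= e0 e1 e2 e3 e4 /hankel.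
by ring.
Qed.

(* Quadrics through the curve form the direct sum of the polars of the cubic
   and of the line spanned by z0 z4 - 4 z1 z3 + 3 z2^2; translating e along the
   frame absorbs the former. *)
Lemma frame_adapted_vector e : h != 0 -> exists c : nat -> K, exists a : K,
  forall z : nat -> K, T (pt z) (pt z) (e + pt c) =
    - (2 * a * h) * (z 0%N * z 4%N - 4 * (z 1%N * z 3%N) + 3 * z 2%N ^+ 2).
Proof.
move=> hn; pose q i j := T (f i) (f j) e.
pose l := [:: - q 2%N 4%N / h; q 1%N 4%N / (2 * h);
  - (q 1%N 3%N + 4 * q 0%N 4%N) / (6 * h); q 0%N 3%N / (2 * h); - q 0%N 2%N / h].
exists (fun k => nth 0 l k), ((q 1%N 3%N - 2 * q 0%N 4%N) / (6 * h)) => z.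
have := frame_quadric_frame z; have := frame_quadric z e.
set p := pt z => /= eq [e0 e1 e2 e3 e4].
rewrite polarD3 eq polar_sum3 !big_ord_recr big_ord0 /= e0 e1 e2 e3 e4.
rewrite -![T _ _ e]/(q _ _); field.
by rewrite hn.
Qed.

End NormalFormOnFrame.

Lemma det_mx33 (K : comRingType) (M : 'M[K]_3) (m := fun i j => M (inord i) (inord j)) :
  \det M =
    m 0%N 0%N * (m 1%N 1%N * m 2%N 2%N - m 1%N 2%N * m 2%N 1%N)
  - m 0%N 1%N * (m 1%N 0%N * m 2%N 2%N - m 1%N 2%N * m 2%N 0%N)
  + m 0%N 2%N * (m 1%N 0%N * m 2%N 1%N - m 1%N 1%N * m 2%N 0%N).
Proof.
have mE (i j : 'I_3) : M i j = m i j by rewrite /m !inord_val.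
rewrite (expand_det_row _ ord0) !big_ord_recl big_ord0 /cofactor.
rewrite !(expand_det_row _ ord0) !big_ord_recl !big_ord0 /cofactor.
by rewrite !det_mx11 !mxE !mE /= /bump /= !(expr0, expr1, exprS); ring.
Qed.

Lemma normal_cubicE (K : numFieldType) a b l (v : 'I_6 -> K)
    (z := fun k : nat => v (inord k)) :
  (normal_cubic a b l).@[v] =
    hankel z - a * z 5%N * (z 0%N * z 4%N - 4 * (z 1%N * z 3%N) + 3 * z 2%N ^+ 2)
    + z 5%N ^+ 2 * (\sum_(i < 5) l 0 i * z i) + (b + 4 * a ^+ 3) * z 5%N ^+ 3.
Proof.
have sumE : (\sum_(i < 5) l 0 i *: xvar K i).@[v] = \sum_(i < 5) l 0 i * z i.
  by rewrite raddf_sum /=; apply: eq_bigr => i _; rewrite mevalZ mevalXU.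
rewrite /normal_cubic !mevalD mevalM mevalZ !rmorphXn /= sumE det_mx33 !mxE /=.
rewrite !inordK //= !(mevalD, mevalN, mevalM, mevalZ, mevalXU) /hankel -!/(z _).
by ring.
Qed.

Lemma in_coordsE (K : numFieldType) n (A : 'M[K]_n.+1) f (v : 'I_n.+1 -> K) :
  (in_coords A f).@[v] = f.@[fun i => \sum_j A i j * v j].
Proof.
rewrite /in_coords comp_mpoly_meval; apply: meval_eq => i.
rewrite tnth_mktuple raddf_sum; apply: eq_bigr => j _.
by rewrite /= mevalZ mevalXU.
Qed.

Section NormalForm.
Variables (K : numFieldType) (F : {mpoly K[6]}).
Hypothesis Fcubic : F \is 3.-homog.
Local Notation vec := 'rV[K]_6.
Local Notation T := (polar F).

Lemma adapted_normal_form (f : nat -> vec) (g : vec) (a h : K)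
    (p := fun z : nat -> K => \sum_(i < 5) z i *: f i) :
  h != 0 -> row_free (\matrix_(i < 6) (if (i < 5)%N then f i else g)) ->
  (forall z, T (p z) (p z) (p z) = 6 * (h * hankel z)) ->
  (forall z, T (p z) (p z) g =
    - (2 * a * h) * (z 0%N * z 4%N - 4 * (z 1%N * z 3%N) + 3 * z 2%N ^+ 2)) ->
  exists (A : 'M[K]_6) (a b c : K) (l : 'rV[K]_5),
    [/\ A \in unitmx, c != 0 & F = c *: in_coords A (normal_cubic a b l)].
Proof.
set M := \matrix_(i < 6) _ => hn; rewrite row_free_unit => Mu Tp Tg.
exists (invmx M)^T, a, (T g g g / (6 * h) - 4 * a ^+ 3), h,
  (\row_i (T (f i) g g / (2 * h))).
split=> //; first by rewrite unitmx_tr unitmx_inv.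
apply: eq_meval => v; rewrite mevalZ in_coordsE normal_cubicE.
pose vr : vec := \row_i v i.
pose y := vr *m invmx M; pose z k := y 0 (inord k).
have zE k : \sum_j (invmx M)^T (inord k) j * v j = z k.
  by rewrite /z /y mxE; apply: eq_bigr => j _; rewrite !mxE mulrC.
rewrite !zE; under [\sum_(i < 5) _]eq_bigr => i _ do rewrite mxE zE.
have -> : hankel (fun k => \sum_j (invmx M)^T (inord k) j * v j) = hankel z.
  by rewrite /hankel !zE.
have vE : vr = p z + z 5%N *: g.
  rewrite -[vr](mulmxKV Mu) mulmx_sum_row big_ord_recr /= rowK /=; congr (_ + _ *: _).
    apply: eq_bigr => i _; rewrite rowK /= ltn_ord /z; congr (y 0 _ *: _).
    by apply: val_inj; rewrite /= inordK // ltnS ltnW.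
  by rewrite /z; congr (y 0 _); apply: val_inj; rewrite /= inordK.
have six : (6 : K) != 0 by rewrite pnatr_eq0.
have -> : F.@[v] = T vr vr vr / 6.
  rewrite polar3E // mulrC mulKf //; apply: meval_eq => i; by rewrite mxE.
have lE : \sum_(i < 5) T (f i) g g / (2 * h) * z i = T (p z) g g / (2 * h).
  rewrite polar_sum1 mulr_suml; apply: eq_bigr => i _; ring.
rewrite lE vE !polarE (polarC12 F g (p z)) !(polarC23 F (p z) g (p z)).
rewrite (polarC12 F g (p z) g) (polarC23 F g g (p z)) (polarC12 F g (p z) g) Tp Tg.
by field; rewrite hn.
Qed.

Variables (C : set (proj_space K 5)) (W : {vspace vec}).
Hypotheses (Cirr : irreducible_closed C) (CW : is_linear_span C W).
Hypotheses (Csing : C `<=` sing_locus F) (dimW : \dim W = 5%N).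
Hypothesis dimF : has_dim (sing_locus F) 1.
Local Notation X := (cone C).

Lemma span4_normal_form : rational_normal_curve 4 C /\
  exists (A : 'M[K]_6) (a b c : K) (l : 'rV[K]_5),
    [/\ A \in unitmx, c != 0 & F = c *: in_coords A (normal_cubic a b l)].
Proof.
have dimW3 : (3 < \dim W)%N by rewrite dimW.
have nonzero := cubic_nonzero_on_span Fcubic Cirr CW Csing dimW3 dimW dimF.
have [U [UW XU TU]] := cone_basis Fcubic Cirr CW Csing dimW nonzero.
have [al [be kerX]] := torus_kernel Fcubic CW Csing UW XU TU.
have [A [Afree AW AX]] := veronese_frame Cirr CW UW XU kerX.
have XA := veronese_cone Cirr CW Afree AW AX.
split; first exact: (veronese_rational_normal Cirr CW Afree AW AX).
pose f k := row (inord k) A.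
pose p (z : nat -> K) := \sum_(i < 5) z i *: f i.
have pE (z : nat -> K) : p z = (\row_i z i) *m A.
  rewrite mulmx_sum_row; apply: eq_bigr => i _.
  by rewrite mxE /f inord_val.
have pW w : w \in W -> exists z, w = p z.
  move=> /AW [y ->]; exists (fun k => y 0 (inord k)); rewrite pE; congr (_ *m A).
  by apply/rowP => i; rewrite mxE inord_val.
have Wp z : p z \in W by apply/AW; rewrite pE; eexists.
have fT t w : T (p (fun i => t ^+ i)) (p (fun i => t ^+ i)) w = 0.
  have -> : p (fun i => t ^+ i) = veronese 4 (pair_row 1 t) *m A.
    rewrite pE; congr (_ *m A); apply/rowP => i.
    by rewrite veroneseE mxE expr1n mul1r.
  apply: (cone_sing Fcubic Csing); apply: XA.
  apply/eqP => /rowP /(_ 0); rewrite !mxE /= => /eqP.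
  by rewrite oner_eq0.
have hn : T (f 0%N) (f 2%N) (f 4%N) != 0.
  apply/eqP => h0; have [x [y [w [Xx Xy Xw]]]] := nonzero.
  have inW := cone_span CW; move/eqP; apply.
  have T0 u : u \in W -> T u u w = 0.
    move=> /pW [z ->]; have [c ->] := pW _ (inW _ Xw).
    have := frame_quadric_frame fT z; rewrite h0 -/(p z) => -[e0 e1 e2 e3 e4].
    rewrite {3}/p polar_sum3 !big_ord_recr big_ord0 /= e0 e1 e2 e3 e4.
    by rewrite !mulr0 !mul0r !mulr0 !addr0.
  have := T0 _ (memvD (inW _ Xx) (inW _ Xy)).
  rewrite !polarE !T0 ?inW // (polarC12 F y x) add0r addr0 -mulr2n => /eqP.
  by rewrite mulrn_eq0 => /eqP.
have [e eW] : exists e : vec, e \notin W.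
  apply: contrapT => He; have : (fullv <= W)%VS.
    apply/subvP => v _; apply/negPn/negP => h; apply: He; by exists v.
  by move=> /dimvS; rewrite dimvf /dim /= mul1n dimW.
have [c [a Tg]] := frame_adapted_vector fT e hn.
apply: (adapted_normal_form hn _ (frame_cubic fT) Tg).
apply: inj_row_free => y y0.
have yE : p (fun k => y 0 (inord k)) + y 0 ord_max *: (e + p c) = 0.
  rewrite -[RHS]y0 mulmx_sum_row big_ord_recr /= rowK /=; congr (_ + _).
  apply: eq_bigr => i _; rewrite rowK /= ltn_ord; congr (y 0 _ *: _).
  by apply: val_inj; rewrite /= inordK // ltnS ltnW.
have y5 : y 0 ord_max = 0.
  apply/eqP; apply: contraNT eW => yn.
  have E : y 0 ord_max *: (e + p c) = - p (fun k => y 0 (inord k)).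
    by apply/eqP; rewrite -addr_eq0 addrC yE.
  rewrite -[e](addrK (p c)) -[e + p c]scale1r -(mulVf yn) -scalerA E.
  by apply: memvB => //; apply: memvZ; rewrite memvN.
move: yE; rewrite y5 scale0r addr0 pE => /eqP; rewrite mulmx_free_eq0 // => /eqP z0.
apply/rowP => i; rewrite [RHS]mxE; have [j ->|->//] := unliftP ord_max i.
have := congr1 (fun r : 'rV_5 => r 0 j) z0; rewrite !mxE => <-.
congr (y 0 _); apply: val_inj; rewrite /= inordK ?ltnS ?(ltnW (ltn_ord j)) //.
by rewrite /bump leqNgt ltn_ord.
Qed.
End NormalForm.

Local Open Scope complex_scope.

Theorem proposition6p6 (R : realType) (F : {mpoly R[i][6]})
    (C : set (proj_space R[i] 5))
    (F_neq0 : F != 0) (F_cubic : F \is 3.-homog)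
    (dim_sing : has_dim (sing_locus F) 1)
    (C_curve : irreducible_curve C)
    (C_sing : C `<=` sing_locus F)
    (C_span : linear_span_dim C 4) :
  rational_normal_curve 4 C /\
  exists (A : 'M[R[i]]_6) (a b c : R[i]) (l : 'rV[R[i]]_5),
    [/\ A \in unitmx, c != 0 & F = c *: in_coords A (normal_cubic a b l)].
Proof.
have [W [CW dimW]] := C_span; have [Cirr _] := C_curve.
exact: (span4_normal_form F_cubic Cirr CW C_sing dimW dim_sing).
Qed.
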